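(* Let $X$ be a connected, locally finite, $d$-dimensional polyhedral complex such that $G\backslash X$ is finite, where $G=\operatorname{Aut}(X)$. Let $L_1,L_2,\ldots,L_m$ be the finite simplicial complexes such that for each vertex $x\in V(X)$, the link $\operatorname{Lk}(x,X)$ is isometric to some $L_i$. Let $$p_1^{\alpha_1}p_2^{\alpha_2}\cdots p_M^{\alpha_M}$$ be the lowest common multiple of the orders of the groups $\operatorname{Aut}(L_i)$, $1\le i\le m$, with each $p_j$ prime, $p_1<p_2<\cdots<p_M$, and $\alpha_j>0$ for $1\le j\le M$. For $1\le i\le m$ and each $(d-1)$-cell $\sigma$ of $L_i$, let $\operatorname{Fix}_i(\sigma)$ be the subgroup of $\operatorname{Aut}(L_i)$ which fixes $\sigma$ pointwise. Let $$p_1^{\alpha_1'}p_2^{\alpha_2'}\cdots p_M^{\alpha_M'}$$ be the lowest common multiple of the orders of the groups $\operatorname{Fix}_i(\sigma)$, over all $1\le i\le m$ and all $(d-1)$-cells $\sigma$ of $L_i$, so that $0\le\alpha_j'\le\alpha_j$ for $1\le j\le M$. Then if $\Gamma$ is a uniform lattice in $G$, its covolume $\mu(\Gamma\backslash G)=a/b$ is a rational in lowest terms, such that $b$ is: (a) not divisible by any primes other than $p_1,p_2,\ldots,p_M$; and (b) if for some $j$ we have $\alpha_j'=0$, then not divisible by $p_j^{\alpha_j+1}$.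
   Context: Let $\mathbb{X}^n$ be $S^n$, $\mathbb{R}^n$ or $\mathbb{H}^n$ with its metric of constant curvature $1$, $0$, $-1$ respectively. A polyhedral complex $X$ is a CW-complex such that (1) each open cell of dimension $n$ is isometric to the interior of a compact convex polyhedron in $\mathbb{X}^n$; and (2) for each cell $\sigma$ of $X$, the restriction of the attaching map to each open codimension 1 face of $\sigma$ is an isometry onto an open cell of $X$. $V(X)$ is the vertex set of $X$. The link $\operatorname{Lk}(x,X)$ of a vertex $x$ of a $d$-dimensional polyhedral complex $X$ is the spherical simplicial complex obtained by intersecting $X$ with a $d$-sphere of sufficiently small radius centred at $x$, rescaled so that the sphere has radius $1$ (this gives the metric on the link). $\operatorname{Aut}(L_i)$ denotes the automorphism group of the finite simplicial complex $L_i$. $\operatorname{Aut}(X)$ is the group of polyhedral isometries of $X$. For a cell $\sigma$ of $X$, the combinatorial balls are defined by: $B(\sigma,0)=\sigma$, and for $n\ge1$, $B(\sigma,n)$ is the union of the $d$-cells of $X$ which meet $B(\sigma,n-1)$. $G=\operatorname{Aut}(X)$ is a locally compact group, with a neighbourhood basis of the identity consisting of automorphisms fixing larger and larger combinatorial balls. A subgroup $\Gamma\le G$ is discrete if and only if the stabiliser $\Gamma_x$ is finite for each $x\in V(X)$. A uniform lattice is a discrete subgroup $\Gamma\le G$ with $\Gamma\backslash G$ compact; when $G\backslash X$ is finite, a discrete subgroup $\Gamma$ is a uniform lattice if and only if the sum below has finitely many terms. The Haar measure $\mu$ on $G$ is normalised so that for all uniform lattices $\Gamma\le G$, $$\mu(\Gamma\backslash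 G)=\operatorname{Vol}(\Gamma\backslash\!\backslash V(X)):=\sum_{x\in\Gamma\backslash V(X)}\frac{1}{|\Gamma_x|}.$$
   Formalization: ''d-dimensional'' is taken to mean pure: every cell of X lies in a closed d-cell, as the combinatorial balls of d-cells presuppose; without this, part (b) is false (e.g. a tree glued by its leaves to a triangulated torus with a free C9-action). *)

(* Defs.v *)
From HB Require Import structures.
From mathcomp Require Import all_boot all_order all_algebra all_fingroup.
From mathcomp Require Import generic_quotient finmap.
From mathcomp Require Import all_classical all_reals all_analysis.
Import Order.TTheory GRing.Theory Num.Theory.
Import numFieldNormedType.Exports.

Set Implicit Arguments.
Unset Strict Implicit.
Unset Printing Implicit Defensive.

Local Open Scope quotient_scope.
Local Open Scope classical_set_scope.
Local Open Scope ring_scope.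

(** * The model spaces S^n, R^n and H^n *)

(* All three are realised as hypersurfaces of R^(n+1): the unit sphere, the
   affine hyperplane x_0 = 1, and the upper sheet of the hyperboloid. In each
   case totally geodesic subspaces are the sections by linear subspaces, and
   geodesic half-spaces the sections by linear half-spaces. *)
Inductive geometry := Spherical | Euclidean | Hyperbolic.

Section ModelSpace.
Context {R : realType} (g : geometry).

Definition dot n (x y : 'rV[R]_n) : R := (x *m y^T) 0 0.

(* The Lorentz form - x_0 y_0 + x_1 y_1 + ... + x_n y_n when g = Hyperbolic. *)
Definition mform n (x y : 'rV[R]_n.+1) : R :=
  if g is Hyperbolic then dot x y - 2 * (x 0 0 * y 0 0) else dot x y.

Definition model n : set 'rV[R]_n.+1 := [set x |
  match g with
  | Spherical => mform x x = 1
  | Euclidean => x 0 0 = 1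
  | Hyperbolic => mform x x = -1 /\ 0 < x 0 0
  end].

Definition acosh (t : R) : R := ln (t + Num.sqrt (t ^+ 2 - 1)).

Definition mdist n (x y : 'rV[R]_n.+1) : R :=
  match g with
  | Spherical => acos (mform x y)
  | Euclidean => Num.sqrt (mform (x - y) (x - y))
  | Hyperbolic => acosh (- mform x y)
  end.

(* A tangent vector at v, pointing along the geodesic from v to y. *)
Definition direction n (v y : 'rV[R]_n.+1) : 'rV[R]_n.+1 :=
  match g with
  | Spherical => y - mform v y *: v
  | Euclidean => y - v
  | Hyperbolic => y + mform v y *: v
  end.

Definition angle n (v y z : 'rV[R]_n.+1) : R :=
  let a := direction v y in let b := direction v z in
  acos (mform a b / (Num.sqrt (mform a a) * Num.sqrt (mform b b))).

(** * Compact convex polyhedra *)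

(* The geodesic convex hull of the rows of V. *)
Definition hull n k (V : 'M[R]_(k, n.+1)) : set 'rV[R]_n.+1 :=
  [set x | model x /\
    exists2 a : 'rV[R]_k, (forall j, 0 <= a 0 j) & x = a *m V].

(* Hulls of finite subsets that lie in no hyperplane, so that the interior is
   nonempty; in the sphere the vertices must lie in an open hemisphere. *)
Definition convex_polyhedron n (P : set 'rV[R]_n.+1) :=
  exists k (V : 'M[R]_(k, n.+1)),
    [/\ forall i, model (row i V),
        row_full V,
        g = Spherical -> exists u : 'rV[R]_n.+1, forall i, 0 < dot u (row i V)
      & P = hull V].

(* The interior of P `&` {l = 0} relative to the section of the model space by
   the linear subspace {l = 0}, which is a hyperplane unless l = 0. *)
Definition relative_interior n (P : set 'rV[R]_n.+1) (l : 'cV[R]_n.+1) :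
    set 'rV[R]_n.+1 :=
  [set x | [/\ P x, x *m l = 0 &
    \forall y \near x, model y -> y *m l = 0 -> P y]].

Definition open_polyhedron n (P : set 'rV[R]_n.+1) := relative_interior P 0.

(* {l = 0} is a supporting hyperplane of P that cuts out a face of
   codimension 1; the open face is then relative_interior P l. *)
Definition defines_facet n (P : set 'rV[R]_n.+1) (l : 'cV[R]_n.+1) :=
  [/\ l != 0,
      forall x, P x -> 0 <= (x *m l) 0 0
    & relative_interior P l !=set0].

(* f and f' parametrise the same subset of T, by A and by B, and the induced
   correspondence between A and B is an isometry. *)
Definition isometric_parametrisations (T : Type) n n'
    (A : set 'rV[R]_n.+1) (f : 'rV[R]_n.+1 -> T)
    (B : set 'rV[R]_n'.+1) (f' : 'rV[R]_n'.+1 -> T) :=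
  f @` A = f' @` B /\
  forall x y x' y', A x -> A y -> B x' -> B y' ->
    f x = f' x' -> f y = f' y' -> mdist x y = mdist x' y'.

End ModelSpace.

(** * Polyhedral complexes *)

(* char_map c is only meaningful on cell_shape c. *)
Record cellStructure (R : realType) := CellStructure {
  space :> topologicalType;
  cell : Type;
  cdim : cell -> nat;
  cell_shape : forall c : cell, set 'rV[R]_(cdim c).+1;
  char_map : forall c : cell, 'rV[R]_(cdim c).+1 -> space }.

Arguments cell_shape {R} {_} c _.
Arguments char_map {R} {_} c _.

Section Cells.
Context {R : realType} (g : geometry) (X : cellStructure R).

Definition open_shape (c : cell X) := open_polyhedron g (cell_shape c).
Arguments open_shape : clear implicits.
Definition open_cell (c : cell X) : set X := char_map c @` open_shape c.
Definition closed_cell (c : cell X) : set X := char_map c @` cell_shape c.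

(* The characteristic maps need not be injective on the boundary. *)
Definition CW_complex :=
  [/\ [/\ hausdorff_space X,
          forall c : cell X, {within cell_shape c, continuous (char_map c)},
          forall c : cell X, set_inj (open_shape c) (char_map c)
        & forall x : X, exists! c, open_cell c x],
      forall c : cell X, exists2 D : set (cell X), finite_set D &
        (forall c', D c' -> (cdim c' < cdim c)%N) /\
        (char_map c @` (cell_shape c `\` open_shape c)
          `<=` \bigcup_(c' in D) open_cell c')
    & forall A : set X,
        (forall c, closed (cell_shape c `&` char_map c @^-1` A)) -> closed A].

Definition polyhedral :=
  (forall c : cell X, convex_polyhedron g (cell_shape c)) /\
  forall (c : cell X) (l : 'cV[R]_(cdim c).+1),
    defines_facet g (cell_shape c) l ->
    exists c' : cell X, cdim c = (cdim c').+1 /\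
      isometric_parametrisations g
        (relative_interior g (cell_shape c) l) (char_map c)
        (open_shape c') (char_map c').

(* Every cell lies in a closed d-cell, so that X is the union of its closed
   d-cells and is exhausted by combinatorial balls when it is connected. *)
Definition pure_of_dim (d : nat) :=
  [/\ exists c : cell X, cdim c = d,
      forall c : cell X, (cdim c <= d)%N
    & forall c : cell X,
        exists2 c', cdim c' = d & closed_cell c `<=` closed_cell c'].

End Cells.

Arguments open_shape {R} g {X} c _.
Arguments open_cell {R} g {X} c _.
Arguments closed_cell {R X} c _.

Record polyhedralComplex (R : realType) (g : geometry) (d : nat) :=
  PolyhedralComplex {
    cells :> cellStructure R;
    complex_CW : CW_complex g cells;
    complex_polyhedral : polyhedral g cells;
    complex_pure : pure_of_dim cells d }.

Section Complex.
Context {R : realType} {g : geometry} {d : nat} (X : polyhedralComplex R g d).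

Definition locally_finite := forall x : X,
  exists2 U, nbhs x U & finite_set [set c | closed_cell c `&` U !=set0].

Definition vertices : set X :=
  [set x | exists2 c, cdim c = 0%N & open_cell g c x].

Fixpoint comb_ball (c : cell X) (n : nat) : set X :=
  if n is n'.+1 then
    \bigcup_(c' in [set c' | cdim c' = d /\
                             closed_cell c' `&` comb_ball c n' !=set0])
      closed_cell c'
  else closed_cell c.

(** * Automorphisms *)

Definition cellular_isometry (f : X -> X) := forall c : cell X,
  exists c' : cell X, cdim c = cdim c' /\
    isometric_parametrisations g
      (open_shape g c) (f \o char_map c) (open_shape g c') (char_map c').

(* Polyhedral isometries: homeomorphisms that carry every open cell
   isometrically onto an open cell, together with their inverse. *)
Record PolyAut := PolyIso {
  aut_fun :> X -> X;
  aut_inv : X -> X;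
  aut_funK : cancel aut_fun aut_inv;
  aut_invK : cancel aut_inv aut_fun;
  aut_fun_continuous : continuous aut_fun;
  aut_inv_continuous : continuous aut_inv;
  aut_fun_cells : cellular_isometry aut_fun;
  aut_inv_cells : cellular_isometry aut_inv }.

Lemma aut_eq (f h : PolyAut) : aut_fun f =1 aut_fun h -> f = h.
Proof.
move=> fh; have inv_fh : aut_inv f = aut_inv h.
  by apply/funext => x; rewrite -{1}(aut_invK h x) -fh aut_funK.
have {}fh : aut_fun f = aut_fun h by apply/funext.
case: f h inv_fh fh => f f' a1 a2 a3 a4 a5 a6 [h h' b1 b2 b3 b4 b5 b6] /= E E'.
by subst h h'; congr PolyIso; exact: Prop_irrelevance.
Qed.

Lemma cellular_isometry_id : cellular_isometry idfun.
Proof.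
move=> c; exists c; split=> //; split=> //= x y x' y' Ax Ay Bx' By' xx' yy'.
have [[_ _ /(_ c) inj_c _] _ _] := complex_CW X.
by rewrite (inj_c x x') ?inE // (inj_c y y') ?inE.
Qed.

Lemma cellular_isometry_comp (f h : X -> X) :
  cellular_isometry f -> cellular_isometry h -> cellular_isometry (f \o h).
Proof.
move=> cf ch c; have [c1 [dim1 [img1 iso1]]] := ch c.
have [c2 [dim2 [img2 iso2]]] := cf c1; exists c2; split; first by rewrite dim1.
have lift x : open_shape g c x ->
    exists2 x1, open_shape g c1 x1 & h (char_map c x) = char_map c1 x1.
  move=> cx; have : (char_map c1 @` open_shape g c1) (h (char_map c x)).
    by rewrite -img1; exists x.
  by case=> x1 c1x1 <-; exists x1.
split.
  rewrite -img2; apply/seteqP; split=> [_ [x cx <-]|_ [x1 c1x1 <-]] /=.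
    by have [x1 c1x1 ->] := lift x cx; exists x1.
  have : (char_map c1 @` open_shape g c1) (char_map c1 x1) by exists x1.
  by rewrite -img1 => -[x cx /= Ex]; exists x => //=; rewrite Ex.
move=> x y x2 y2 cx cy c2x c2y /= ex ey.
have [x1 c1x Ex] := lift x cx; have [y1 c1y Ey] := lift y cy.
rewrite (iso1 x y x1 y1) //; apply: iso2 => //=; first by rewrite -Ex.
by rewrite -Ey.
Qed.

Definition aut_one : PolyAut := @PolyIso idfun idfun
  (fun=> erefl) (fun=> erefl) (fun=> cvg_id) (fun=> cvg_id)
  cellular_isometry_id cellular_isometry_id.

Definition aut_inverse (f : PolyAut) : PolyAut := PolyIso
  (aut_invK f) (aut_funK f) (@aut_inv_continuous f) (@aut_fun_continuous f)
  (aut_inv_cells f) (aut_fun_cells f).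

Definition aut_mul (f h : PolyAut) : PolyAut := @PolyIso
  (f \o h) (aut_inv h \o aut_inv f)
  (can_comp (aut_funK f) (aut_funK h)) (can_comp (aut_invK h) (aut_invK f))
  (fun x => continuous_comp (@aut_fun_continuous h x) (@aut_fun_continuous f _))
  (fun x => continuous_comp (@aut_inv_continuous f x) (@aut_inv_continuous h _))
  (cellular_isometry_comp (aut_fun_cells f) (aut_fun_cells h))
  (cellular_isometry_comp (aut_inv_cells h) (aut_inv_cells f)).

HB.instance Definition _ := gen_eqMixin PolyAut.
HB.instance Definition _ := gen_choiceMixin PolyAut.
HB.instance Definition _ := isPointed.Build PolyAut aut_one.

Fact aut_mulA : associative aut_mul. Proof. by move=> *; exact: aut_eq. Qed.
Fact aut_mul1 : left_id aut_one aut_mul. Proof. by move=> *; exact: aut_eq. Qed.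
Fact aut_mulr1 : right_id aut_one aut_mul. Proof. by move=> *; exact: aut_eq. Qed.
Fact aut_mulV : left_inverse aut_one aut_inverse aut_mul.
Proof. by move=> f; apply: aut_eq => x /=; rewrite aut_funK. Qed.
Fact aut_mulrV : right_inverse aut_one aut_inverse aut_mul.
Proof. by move=> f; apply: aut_eq => x /=; rewrite aut_invK. Qed.

HB.instance Definition _ := isGroup.Build PolyAut
  aut_mulA aut_mul1 aut_mulr1 aut_mulV aut_mulrV.

(* The topology with a subbase consisting of the left cosets of the pointwise
   stabilisers of combinatorial balls. *)
HB.instance Definition _ := isSubBaseTopological.Build PolyAut
  [set U : set PolyAut | exists (f : PolyAut) (c : cell X) (n : nat),
     U = [set h : PolyAut | forall x, comb_ball c n x -> h x = f x]] idfun.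

(* Finiteness of G \ X, as a cell complex. *)
Definition finite_quotient := finite_set
  (range (fun c : cell X => [set c' : cell X |
     exists f : PolyAut, f @` open_cell g c = open_cell g c'])).

(** * Lattices and covolumes *)

Section Subgroup.
Variable Gamma : groupClosed PolyAut.

Definition coset_rel (f h : PolyAut) : bool := (h * f^-1)%g \in Gamma.

Fact coset_rel_refl : reflexive coset_rel.
Proof. by move=> f; rewrite /coset_rel mulgV gpred1. Qed.
Fact coset_rel_sym : symmetric coset_rel.
Proof.
have imp f h : coset_rel f h -> coset_rel h f.
  by rewrite /coset_rel => /gpredVr; rewrite invgM invgK.
by move=> f h; apply/idP/idP; exact: imp.
Qed.
Fact coset_rel_trans : transitive coset_rel.
Proof.
move=> h f k; rewrite /coset_rel => fh hk.
by have := gpredM _ _ hk fh; rewrite mulgA mulgVK.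
Qed.

Canonical coset_equiv := EquivRel coset_rel
  coset_rel_refl coset_rel_sym coset_rel_trans.

(* Gamma \ G, with the quotient topology. *)
Definition coset_space := quotient_topology {eq_quot coset_equiv}.

Definition discrete_subgroup :=
  [set` Gamma] `<=` isolated [set` Gamma].

Definition uniform_lattice :=
  discrete_subgroup /\ compact [set: coset_space].

Definition orbit_rel (x y : X) : bool :=
  `[< exists2 f : PolyAut, f \in Gamma & f x = y >].

Fact orbit_rel_refl : reflexive orbit_rel.
Proof. by move=> x; apply/asboolP; exists 1%g => //; exact: gpred1. Qed.
Fact orbit_rel_sym : symmetric orbit_rel.
Proof.
have imp x y : orbit_rel x y -> orbit_rel y x.
  move=> /asboolP[f Gf <-]; apply/asboolP; exists (f^-1)%g; first exact: gpredVr.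
  exact: aut_funK.
by move=> x y; apply/idP/idP; exact: imp.
Qed.
Fact orbit_rel_trans : transitive orbit_rel.
Proof.
move=> y x z /asboolP[f Gf <-] /asboolP[h Gh <-]; apply/asboolP.
by exists (h * f)%g => //; exact: gpredM.
Qed.

Canonical orbit_equiv := EquivRel orbit_rel
  orbit_rel_refl orbit_rel_sym orbit_rel_trans.

Definition orbit_space := {eq_quot orbit_equiv}.

Definition stabiliser (x : X) : set PolyAut :=
  [set f | f \in Gamma /\ f x = x].

(* The sum of 1 / |Gamma_x| over Gamma \ V(X); an orbit q consists of vertices
   iff repr q is a vertex, and an infinite stabiliser contributes 0. *)
Definition orbifold_volume : \bar R :=
  \esum_(q in [set q : orbit_space | vertices (repr q)])
    ((#|` fset_set (stabiliser (repr q))|)%fset%:R^-1)%:E.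

End Subgroup.

Definition borelAut := g_sigma_algebraType (@open PolyAut).

Definition haar_measure (mu : {measure set borelAut -> \bar R}) :=
  [/\ forall (f : PolyAut) (A : set borelAut), measurable A ->
        mu ((fun h : PolyAut => (f * h)%g) @` A) = mu A,
      forall K : set PolyAut, compact K -> (mu K < +oo)%E
    & forall U : set PolyAut, open U -> U !=set0 -> (0 < mu U)%E].

(* Borel sets that meet every coset Gamma h in exactly one point. *)
Definition fundamental_domain (Gamma : groupClosed PolyAut)
    (F : set borelAut) :=
  measurable F /\
  set_bij F [set: coset_space Gamma]
    (fun f : PolyAut => \pi_(coset_space Gamma) f).

(* mu (Gamma \ G): the measure of any fundamental domain; left invariance makes
   it independent of the choice when Gamma is a lattice. *)
Definition covolume (mu : {measure set borelAut -> \bar R})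
    (Gamma : groupClosed PolyAut) : \bar R :=
  get [set mu F | F in fundamental_domain Gamma].

Definition normalised_covolume (mu : {measure set borelAut -> \bar R}) :=
  forall Gamma : groupClosed PolyAut, uniform_lattice Gamma ->
    covolume mu Gamma = orbifold_volume Gamma.

End Complex.

Arguments vertices {R g d} X _.

(** * Finite spherical simplicial complexes and links *)

(* The metric is given by the lengths of the edges: cosine s t is the cosine of
   the length of the edge {s, t}, and is irrelevant if {s, t} is not an edge.
   Positive definiteness on a simplex says that there is a spherical simplex
   with these edge lengths. *)
Record sphericalComplex (R : realType) := SphericalComplex {
  lvertex : finType;
  simplices : {set {set lvertex}};
  cosine : lvertex -> lvertex -> R;
  simplices_neq0 : finset.set0 \notin simplices;
  simplices_vertex : forall t, finset.set1 t \in simplices;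
  simplices_face : forall s t : {set lvertex}, s \in simplices ->
    t \subset s -> t != finset.set0 -> t \in simplices;
  cosine_diag : forall t, cosine t t = 1;
  cosine_sym : forall s t, cosine s t = cosine t s;
  cosine_posdef : forall (s : {set lvertex}) (w : lvertex -> R),
    s \in simplices -> (exists2 t, t \in s & w t != 0) ->
    0 < \sum_(a in s) \sum_(b in s) w a * w b * cosine a b }.

Section SimplicialComplex.
Context {R : realType} (L : sphericalComplex R).

Definition saut : {set {perm lvertex L}} :=
  [set f : {perm lvertex L} |
     [forall s : {set lvertex L},
        (f @: s \in simplices L) == (s \in simplices L)]]%SET.

Lemma saut_group_set : group_set saut.
Proof.
apply/group_setP; split=> [|f h]; rewrite !inE.
  apply/forallP => s; have -> : [set (1 : {perm lvertex L})%g x | x in s]%SET = s.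
    by apply/setP => x; rewrite (eq_imset _ (@perm1 _)) imset_id.
  exact: eqxx.
move=> /forallP af /forallP ah; apply/forallP => s.
have -> : [set (f * h)%g x | x in s]%SET = (h @: (f @: s))%SET.
  by rewrite -imset_comp; apply: eq_imset => x; rewrite permM.
by rewrite (eqP (ah _)) (eqP (af _)).
Qed.
Canonical saut_group := Group saut_group_set.

(* The automorphisms fixing every vertex of s, that is, fixing pointwise the
   simplex spanned by s in the realisation. *)
Definition sfix (s : {set lvertex L}) : {set {perm lvertex L}} :=
  ('C_saut(s | 'P))%g.

Definition wsupport (w : {ffun lvertex L -> R}) : {set lvertex L} :=
  [set t | w t != 0]%SET.

Definition lform (w w' : {ffun lvertex L -> R}) : R :=
  \sum_a \sum_b w a * w' b * cosine a b.

(* w stands for the unit vector \sum_t w_t e_t of the simplex spanned by its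
   support, the unit vectors e_t having Gram matrix given by cosine; the
   distance between two points of a common simplex is acos (lform w w'). *)
Definition realisation := [set w : {ffun lvertex L -> R} |
  [/\ forall t, 0 <= w t,
      wsupport w \in simplices L
    & lform w w = 1]].

Definition closed_simplex (s : {set lvertex L}) :=
  [set w | realisation w /\ wsupport w \subset s].

End SimplicialComplex.

Section Link.
Context {R : realType} {g : geometry} {d : nat} {X : polyhedralComplex R g d}.

(* The cells of Lk(x, X) are indexed by the pairs of a cell c of positive
   dimension and a point v of cell_shape c over x. When x is a vertex of X, such
   a v is automatically a vertex of cell_shape c; c may have several of them. *)
Definition corner (x : X) (c : cell X) (v : 'rV[R]_(cdim c).+1) :=
  [/\ (0 < cdim c)%N, cell_shape c v & char_map c v = x].

Definition corner_sphere (c : cell X) (v : 'rV[R]_(cdim c).+1) (r : R) :=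
  [set y | cell_shape c y /\ mdist g v y = r].

Definition link_sphere (x : X) (r : R) : set X :=
  [set z | exists (c : cell X) (v : 'rV[R]_(cdim c).+1),
     corner x v /\ (char_map c @` corner_sphere v r) z].

(* h maps the simplex s isometrically onto the cell of the link given by a
   corner, which carries the angular metric. *)
Definition link_cell_isometry (L : sphericalComplex R) (c : cell X)
    (v : 'rV[R]_(cdim c).+1) (r : R) (h : {ffun lvertex L -> R} -> X)
    (s : {set lvertex L}) :=
  [/\ s \in simplices L, #|s| = cdim c,
      h @` closed_simplex s = char_map c @` corner_sphere v r
    & forall w w' y y', closed_simplex s w -> closed_simplex s w' ->
        corner_sphere v r y -> corner_sphere v r y' ->
        h w = char_map c y -> h w' = char_map c y' ->
        acos (lform w w') = angle g v y y'].

(* Lk(x, X), the sphere of sufficiently small radius r about x, is isometric to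
   L by an isometry that matches the cells. *)
Definition link_isometric (x : X) (L : sphericalComplex R) :=
  \forall r \near (0 : R)^'+,
    exists h : {ffun lvertex L -> R} -> X,
      [/\ set_bij (@realisation R L) (link_sphere x r) h,
          forall (c : cell X) (v : 'rV[R]_(cdim c).+1), corner x v ->
            exists s, link_cell_isometry v r h s
        & forall s, s \in simplices L ->
            exists (c : cell X) (v : 'rV[R]_(cdim c).+1),
              corner x v /\ link_cell_isometry v r h s].

End Link.

(* Main.v *)
From HB Require Import structures.
Require Import Defs.
From mathcomp Require Import all_boot all_order all_algebra all_fingroup.
From mathcomp Require Import cyclic pgroup sylow generic_quotient.
From mathcomp Require Import finmap all_classical all_reals all_analysis.
From mathcomp Require Import ring lra.
Import Order.TTheory GRing.Theory Num.Theory.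
Import numFieldNormedType.Exports.

(** The covolume of a uniform lattice [Gamma] is the sum of the [1 / |Gamma_x|]
    over the orbits of vertices. Since [Gamma \ G] is compact, each of the
    finitely many [G]-orbits of vertices splits into finitely many
    [Gamma]-orbits ([finite_vertex_orbits]); so the sum is finite, and a prime
    power that divides its denominator divides the order of a finite stabiliser
    [Gamma_x] ([orbifold_volume_fraction]). It remains to bound the prime powers
    that divide the order of a finite group [T] of automorphisms fixing a vertex
    [x].

    The group that fixes a vertex acts on its link by simplicial automorphisms
    ([local_representation]), and an element that acts trivially fixes all the
    closed cells at this vertex ([link_action_faithful_cell]). As adjacent cells
    share a vertex and the complex is connected, an element that fixes a [d]-cell
    pointwise is trivial as soon as, at each vertex of each [d]-cell that it
    fixes, it acts trivially on the link ([fixes_all]). For an element of prime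
    order [q], this happens if [q] divides no [|Aut L_i|]; by Cauchy's theorem,
    every prime divisor of [|T|] divides some [|Aut L_i|]
    ([prime_divides_link]). It also happens if the element acts trivially on one
    link and [q] divides no [|Fix_i s|], because an element that fixes a [d]-cell
    fixes a [(d-1)]-cell of the link of each vertex of this cell. In this case a
    Sylow [q]-subgroup of [T] acts faithfully on the link of [x], and its order
    divides [|Aut L_i|] ([sylow_divides_link]).

    The geometric part concerns the faithfulness of the action on a small sphere
    about a vertex. The polyhedra are sections of cones of an ambient vector
    space by the model space, and isometries between them are linear, because
    distances determine a Gram matrix ([isometry_extension]). An automorphism
    that acts trivially on a link maps to itself each piece of the sphere, which
    contains points on a spanning set of rays from the vertex. The faces of a
    closed cell are obtained from its facets, whose open parts are dense in its
    boundary ([hull_facet]). *)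

Set Implicit Arguments.
Unset Strict Implicit.
Unset Printing Implicit Defensive.

Local Open Scope classical_set_scope.
Local Open Scope ring_scope.

Local Notation mdist := Defs.mdist.

(** * The ambient bilinear forms *)

Section Forms.
Context {R : realType}.

Lemma sqr_le_imp (a b : R) : 0 <= b -> a ^+ 2 <= b ^+ 2 -> a <= b.
Proof.
move=> b0; have [a0|a0 _] := lerP 0 a; first by rewrite ler_pXn2r.
exact: le_trans (ltW a0) b0.
Qed.

Lemma dotE n (x y : 'rV[R]_n) : dot x y = \sum_i x 0 i * y 0 i.
Proof. by rewrite /dot mxE; apply: eq_bigr => i _; rewrite mxE. Qed.

Lemma dotC n (x y : 'rV[R]_n) : dot x y = dot y x.
Proof. by rewrite !dotE; apply: eq_bigr => i _; rewrite mulrC. Qed.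

Lemma dotDl n (x y z : 'rV[R]_n) : dot (x + y) z = dot x z + dot y z.
Proof. by rewrite /dot mulmxDl mxE. Qed.

Lemma dotZl n a (x z : 'rV[R]_n) : dot (a *: x) z = a * dot x z.
Proof. by rewrite /dot -scalemxAl mxE. Qed.

Lemma dotDr n (x y z : 'rV[R]_n) : dot z (x + y) = dot z x + dot z y.
Proof. by rewrite dotC dotDl !(dotC z). Qed.

Lemma dotZr n a (x z : 'rV[R]_n) : dot z (a *: x) = a * dot z x.
Proof. by rewrite dotC dotZl (dotC z). Qed.

Lemma dotNl n (x z : 'rV[R]_n) : dot (- x) z = - dot x z.
Proof. by rewrite -scaleN1r dotZl mulN1r. Qed.

Lemma dotNr n (x z : 'rV[R]_n) : dot z (- x) = - dot z x.
Proof. by rewrite dotC dotNl (dotC z). Qed.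

Lemma dot_sqrB n (x y : 'rV[R]_n) :
  dot (x - y) (x - y) = dot x x - 2 * dot x y + dot y y.
Proof. by rewrite !(dotDl, dotDr, dotNl, dotNr) (dotC y x); ring. Qed.

Lemma dot_ge0 n (x : 'rV[R]_n) : 0 <= dot x x.
Proof. by rewrite dotE; apply: sumr_ge0 => i _; rewrite -expr2 sqr_ge0. Qed.

Lemma dot_eq0 n (x : 'rV[R]_n) : dot x x = 0 -> x = 0.
Proof.
rewrite dotE => /eqP; rewrite psumr_eq0; last first.
  by move=> i _; rewrite -expr2 sqr_ge0.
move=> /allP x0; apply/rowP => i; rewrite mxE; apply/eqP.
by have := x0 i (mem_index_enum i); rewrite /= mulf_eq0 orbb.
Qed.

(** The form is nonnegative at [dot y y *: x - dot x y *: y]. *)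
Lemma dot_cauchy_schwarz n (x y : 'rV[R]_n) :
  dot x y ^+ 2 <= dot x x * dot y y.
Proof.
have [y0|yN0] := eqVneq (dot y y) 0.
  by rewrite (dot_eq0 y0) /dot trmx0 !mulmx0 mxE expr0n mulr0.
have yy_gt0 : 0 < dot y y by rewrite lt0r yN0 dot_ge0.
have := dot_ge0 (dot y y *: x + (- dot x y) *: y).
rewrite !(dotDl, dotDr, dotZl, dotZr) (dotC y x).
rewrite [leRHS](_ : _ = dot y y * (dot x x * dot y y - dot x y ^+ 2)); last by ring.
by rewrite pmulr_rge0// subr_ge0.
Qed.

Section Mform.
Variables (g : geometry) (n : nat).
Implicit Types x y z : 'rV[R]_n.+1.

(** The Gram matrix of [mform]. *)
Definition form_matrix : 'M[R]_n.+1 :=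
  if g is Hyperbolic then 1%:M - 2 *: delta_mx 0 0 else 1%:M.

Lemma mformE x y : mform g x y = (x *m form_matrix *m y^T) 0 0.
Proof.
rewrite /mform /form_matrix; case: g; rewrite ?mulmx1 //.
rewrite mulmxBr mulmx1 mulmxBl /dot [in RHS]mxE; congr (_ + _).
rewrite [in RHS]mxE -scalemxAr -scalemxAl [in RHS]mxE; congr (- (_ * _)).
rewrite -(mul_delta_mx (0 : 'I_1)) mulmxA -colE -mulmxA [in RHS]mxE big_ord1.
by rewrite -rowE !mxE.
Qed.

Lemma mformC x y : mform g x y = mform g y x.
Proof. by rewrite /mform dotC (mulrC (x 0 0)). Qed.

Lemma mformDl x y z : mform g (x + y) z = mform g x z + mform g y z.
Proof. by rewrite !mformE !mulmxDl mxE. Qed.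

Lemma mformZl a x z : mform g (a *: x) z = a * mform g x z.
Proof. by rewrite !mformE -!scalemxAl mxE. Qed.

Lemma mformDr x y z : mform g z (x + y) = mform g z x + mform g z y.
Proof. by rewrite mformC mformDl !(mformC z). Qed.

Lemma mformZr a x z : mform g z (a *: x) = a * mform g z x.
Proof. by rewrite mformC mformZl (mformC z). Qed.

Lemma mformNl x z : mform g (- x) z = - mform g x z.
Proof. by rewrite -scaleN1r mformZl mulN1r. Qed.

Lemma mformNr x z : mform g z (- x) = - mform g z x.
Proof. by rewrite mformC mformNl (mformC z). Qed.

End Mform.

Definition mform_bilin := (mformDl, mformDr, mformZl, mformZr, mformNl, mformNr).

(** The part of [x] orthogonal to the time axis. *)
Definition space_part n (x : 'rV[R]_n.+1) := x - x 0 0 *: delta_mx 0 0.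

Lemma mform_space_part n (x y : 'rV[R]_n.+1) :
  mform Hyperbolic x y = dot (space_part x) (space_part y) - x 0 0 * y 0 0.
Proof.
have de z : dot z (delta_mx 0 0) = z 0 0.
  by rewrite /dot trmx_delta -colE mxE.
have dee : (delta_mx 0 0 : 'rV[R]_n.+1) 0 0 = 1 by rewrite mxE !eqxx.
rewrite /mform /space_part !(dotDl, dotDr, dotNl, dotNr, dotZl, dotZr).
rewrite (dotC (delta_mx 0 0)) !de dee; ring.
Qed.

(** By Cauchy-Schwarz, the product of the space parts is smaller than that of
    the time coordinates, since each space part is shorter than the time
    coordinate of its vector. *)
Lemma mform_timelike_lt0 n (x y : 'rV[R]_n.+1) :
  0 < x 0 0 -> 0 < y 0 0 ->
  mform Hyperbolic x x < 0 -> mform Hyperbolic y y < 0 ->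
  mform Hyperbolic x y < 0.
Proof.
rewrite !mform_space_part => x0 y0.
set a := dot _ _; set b := dot _ _; set c := dot (space_part x) (space_part y).
move=> xx yy; have cs : c ^+ 2 <= a * b by exact: dot_cauchy_schwarz.
rewrite subr_lt0 ltNge; apply/negP => le_c.
have a0 : 0 <= a by exact: dot_ge0. have b0 : 0 <= b by exact: dot_ge0.
have : (x 0 0 * y 0 0) ^+ 2 <= c ^+ 2.
  have xy0 : 0 <= x 0 0 * y 0 0 by exact: mulr_ge0 (ltW x0) (ltW y0).
  by rewrite lerXn2r ?nnegrE //; exact: le_trans le_c.
apply/negP; rewrite -ltNge; apply: le_lt_trans cs _.
apply: (@le_lt_trans _ _ (a * (y 0 0 * y 0 0))).
  by rewrite ler_wpM2l // -subr_le0 ltW.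
rewrite exprMn -!expr2 ltr_pM2r ?exprn_gt0 // expr2; lra.
Qed.

Lemma model_time_ge1 n (z : 'rV[R]_n.+1) : model Hyperbolic z -> 1 <= z 0 0.
Proof.
case; rewrite mform_space_part => zz z0; have dz := dot_ge0 (space_part z).
by apply: sqr_le_imp; [exact: ltW | rewrite expr1n expr2; lra].
Qed.

(** Cauchy-Schwarz for the space parts, whose squared lengths [x0 ^+ 2 - 1] and
    [y0 ^+ 2 - 1] have product [(x0 * y0 - 1) ^+ 2 - (x0 - y0) ^+ 2]. *)
Lemma mform_model_le n (x y : 'rV[R]_n.+1) :
  model Hyperbolic x -> model Hyperbolic y ->
  mform Hyperbolic x y <= -1 ?= iff (x == y).
Proof.
move=> mx my; have x1 := model_time_ge1 mx; have y1 := model_time_ge1 my.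
case: mx my => [xx x0] [yy y0].
have cs := dot_cauchy_schwarz (space_part x) (space_part y).
move: xx yy cs; rewrite !mform_space_part.
move Ea : (dot (space_part x) (space_part x)) => a.
move Eb : (dot (space_part y) (space_part y)) => b.
move Ec : (dot (space_part x) (space_part y)) => c => xx yy cs.
have ab : a * b = (x 0 0 * y 0 0 - 1) ^+ 2 - (x 0 0 - y 0 0) ^+ 2.
  have -> : a = x 0 0 * x 0 0 - 1 by lra.
  have -> : b = y 0 0 * y 0 0 - 1 by lra.
  ring.
have xy1 : 1 <= x 0 0 * y 0 0 by rewrite -[leLHS]mulr1 ler_pM.
have le : c <= x 0 0 * y 0 0 - 1.
  have : c ^+ 2 <= (x 0 0 * y 0 0 - 1) ^+ 2.
    by apply: le_trans cs _; rewrite ab gerBl sqr_ge0.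
  have xy0 : 0 <= x 0 0 * y 0 0 - 1 by rewrite subr_ge0.
  exact: sqr_le_imp.
split; first by lra.
apply/eqP/eqP => [e|e]; last by move: Ec; rewrite -e Ea => <-; lra.
have ec : c = x 0 0 * y 0 0 - 1 by lra.
have e0 : x 0 0 = y 0 0.
  apply/eqP; rewrite -subr_eq0 -sqrf_eq0 eq_le sqr_ge0 andbT.
  by move: cs; rewrite ec ab; lra.
have : dot (space_part x - space_part y) (space_part x - space_part y) = 0.
  rewrite dot_sqrB Ea Eb Ec.
  by move: xx yy ec; rewrite e0; lra.
move=> /dot_eq0/eqP; rewrite subr_eq0 /space_part e0 => /eqP/addIr.
by [].
Qed.

End Forms.

(** * Distances in the model spaces *)

Section Gauge.
Context {R : realType}.

(** An increasing function of the distance that is polynomial in the points, so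
    that it is easily seen to be continuous, and that determines scalar
    products of the points, or in Euclidean geometry of their differences, so
    that isometries are seen to be linear. *)
Definition gauge g n (x y : 'rV[R]_n.+1) : R :=
  if g is Euclidean then mform g (x - y) (x - y) else - mform g x y.

Arguments gauge : simpl never.

Definition dist_of_gauge g (t : R) : R :=
  match g with
  | Spherical => acos (- t)
  | Euclidean => Num.sqrt t
  | Hyperbolic => acosh t
  end.

Definition gauge_of_dist g (r : R) : R :=
  match g with
  | Spherical => - cos r
  | Euclidean => r ^+ 2
  | Hyperbolic => (expR r + expR (- r)) / 2
  end.

Definition gauge_min g : R :=
  match g with Spherical => -1 | Euclidean => 0 | Hyperbolic => 1 end.

Lemma mdistE g n (x y : 'rV[R]_n.+1) :
  mdist g x y = dist_of_gauge g (gauge g x y).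
Proof. by case: g; rewrite /gauge /= ?opprK. Qed.

(** Nonnegativity of the form at [x - y] in the first two geometries, and the
    reverse Cauchy-Schwarz inequality in the third. *)
Lemma gauge_ge g n (x y : 'rV[R]_n.+1) : model g x -> model g y ->
  gauge_min g <= gauge g x y ?= iff (x == y).
Proof.
case: g; rewrite /gauge /gauge_min.
- rewrite /model /mform /= => xx yy.
  have := dot_sqrB x y; rewrite xx yy => e; have := dot_ge0 (x - y) => ge0.
  split; first by lra.
  apply/eqP/eqP => [d|<-]; last by rewrite xx.
  by apply/subr0_eq/dot_eq0; lra.
- move=> _ _; rewrite /mform; split; first exact: dot_ge0.
  apply/eqP/eqP => [/esym/dot_eq0/subr0_eq//|->].
  by rewrite subrr /dot mul0mx mxE.
- move=> mx my; have [le e] := mform_model_le mx my.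
  by split; [rewrite lerNr | rewrite -e -eqr_oppLR eq_sym].
Qed.

Lemma gauge_le1 n (x y : 'rV[R]_n.+1) : model Spherical x -> model Spherical y ->
  gauge Spherical x y <= 1.
Proof.
rewrite /gauge /model /mform /= => xx yy.
have := dot_sqrB x (- y); have := dot_ge0 (x - - y).
by rewrite !(dotNl, dotNr) opprK xx yy; lra.
Qed.

Lemma gauge_acos_range n (x y : 'rV[R]_n.+1) :
  model Spherical x -> model Spherical y -> -1 <= - gauge Spherical x y <= 1.
Proof.
move=> mx my; have [ge _] := gauge_ge mx my; have le := gauge_le1 mx my.
by apply/andP; split; [rewrite lerN2 | rewrite lerNl].
Qed.

Lemma acosh_sqr (t : R) : 1 <= t ->
  (t + Num.sqrt (t ^+ 2 - 1)) * (t - Num.sqrt (t ^+ 2 - 1)) = 1.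
Proof.
move=> t1; rewrite mulrC -subr_sqr sqr_sqrtr; first by ring.
by rewrite subr_ge0 expr_ge1 // (le_trans ler01).
Qed.

Lemma gauge_of_mdist g n (x y : 'rV[R]_n.+1) : model g x -> model g y ->
  gauge_of_dist g (mdist g x y) = gauge g x y.
Proof.
move=> mx my; have [ge _] := gauge_ge mx my; rewrite mdistE.
case: g mx my ge => mx my ge /=.
- by rewrite acosK; [rewrite opprK | rewrite in_itv; exact: gauge_acos_range].
- exact: sqr_sqrtr.
- move: {mx my} (gauge _ _ _) ge => t /= ge.
  have sq := acosh_sqr ge; have s0 : 0 <= Num.sqrt (t ^+ 2 - 1) by exact: sqrtr_ge0.
  have u0 : 0 < t + Num.sqrt (t ^+ 2 - 1) by lra.
  rewrite /acosh expRN lnK ?posrE //.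
  rewrite (_ : (t + Num.sqrt (t ^+ 2 - 1))^-1 = t - Num.sqrt (t ^+ 2 - 1)).
    by field.
  by apply: (mulfI (lt0r_neq0 u0)); rewrite divff ?lt0r_neq0 // sq.
Qed.

Lemma mdist_gauge_inj g n n' (x y : 'rV[R]_n.+1) (x' y' : 'rV[R]_n'.+1) :
  model g x -> model g y -> model g x' -> model g y' ->
  mdist g x y = mdist g x' y' -> gauge g x y = gauge g x' y'.
Proof.
by move=> mx my mx' my' e; rewrite -(gauge_of_mdist mx my) -(gauge_of_mdist mx' my') e.
Qed.

Lemma mdist_ge0 g n (x y : 'rV[R]_n.+1) : model g x -> model g y ->
  0 <= mdist g x y.
Proof.
move=> mx my; have [ge _] := gauge_ge mx my; rewrite mdistE.
case: g mx my ge => mx my ge /=.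
- by rewrite acos_ge0 // gauge_acos_range.
- exact: sqrtr_ge0.
- by rewrite /acosh ln_ge0 //; move: ge => /=; have := sqrtr_ge0 (gauge Hyperbolic x y ^+ 2 - 1); lra.
Qed.

Lemma gauge_of_dist0 g : gauge_of_dist g 0 = gauge_min g.
Proof. by case: g; rewrite /= ?cos0 ?expr0n // oppr0 expR0; lra. Qed.

Lemma mdist_gt0 g n (x y : 'rV[R]_n.+1) : model g x -> model g y ->
  x != y -> 0 < mdist g x y.
Proof.
move=> mx my; rewrite lt_def mdist_ge0 // andbT; apply: contraNneq => d0.
have [_ <-] := gauge_ge mx my.
by rewrite -gauge_of_mdist // d0 gauge_of_dist0.
Qed.

Definition dist_range g (r : R) := 0 <= r /\ (g = Spherical -> r <= pi).

Lemma mdist_range g n (x y : 'rV[R]_n.+1) : model g x -> model g y ->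
  dist_range g (mdist g x y).
Proof.
move=> mx my; split; first exact: mdist_ge0.
move=> gs; subst g; have [ge _] := gauge_ge mx my; rewrite mdistE /=.
by rewrite acos_lepi // gauge_acos_range.
Qed.

Lemma gauge_of_distK g r : dist_range g r ->
  dist_of_gauge g (gauge_of_dist g r) = r.
Proof.
case: g => -[r0 rpi] /=.
- by rewrite opprK cosK // in_itv /= r0 rpi.
- by rewrite sqrtr_sqr ger0_norm.
- rewrite /acosh expRN; set u := expR r.
  have u1 : 1 <= u by rewrite -expR0 ler_expR.
  have u0 : 0 < u by exact: lt_le_trans u1.
  have uv : u * u^-1 = 1 by rewrite divff ?lt0r_neq0.
  have v1 : u^-1 <= 1 by rewrite invf_le1.
  rewrite (_ : _ ^+ 2 - 1 = ((u - u^-1) / 2) ^+ 2).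
    rewrite sqrtr_sqr ger0_norm; last by lra.
    by rewrite (_ : _ + _ = u) ?expRK //; lra.
  rewrite !expr_div_n sqrrB sqrrD uv; lra.
Qed.

Lemma ler_gauge_of_dist g r s : dist_range g s -> 0 <= r <= s ->
  gauge_of_dist g r <= gauge_of_dist g s.
Proof.
case: g => -[s0 spi] /= /andP[r0 rs].
- rewrite lerN2; move: rs; rewrite le_eqVlt => /predU1P[->//|rs].
  have {}spi := spi erefl; apply/ltW; rewrite ltr_cos // in_itv /=; lra.
- by rewrite ler_pXn2r.
- rewrite !expRN; set u := expR r; set w := expR s.
  have u1 : 1 <= u by rewrite -expR0 ler_expR.
  have uw : u <= w by rewrite ler_expR.
  have u0 : 0 < u by exact: lt_le_trans u1.
  have w0 : 0 < w by exact: lt_le_trans uw.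
  have : 0 <= (w - u) * (1 - u^-1 * w^-1).
    rewrite mulr_ge0 ?subr_ge0 // mulr_ile1 ?invr_ge0 ?invf_le1 //.
    - exact: ltW.
    - exact: ltW.
    - exact: le_trans uw.
  rewrite (_ : _ * _ = w + w^-1 - (u + u^-1)); first by lra.
  by field; rewrite !lt0r_neq0.
Qed.

End Gauge.

(** * Central projection onto the model space *)

Arguments mform : simpl never.

Section MatrixContinuity.
Context {R : realType}.

Lemma eq_continuous_at (T U : topologicalType) (h f : T -> U) x :
  f =1 h -> {for x, continuous h} -> {for x, continuous f}.
Proof. by move=> /funext ->. Qed.

Lemma sum_continuous_at (T : topologicalType) (I : finType) (F : I -> T -> R) x :
  (forall i, {for x, continuous (F i)}) ->
  {for x, continuous (fun t => \sum_i F i t)}.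
Proof.
move=> Fc; elim: (index_enum I) => [|i s ih].
  apply: (@eq_continuous_at _ _ (fun=> 0)) => [t|]; first by rewrite big_nil.
  exact: cvg_cst.
apply: (@eq_continuous_at _ _ (fun t => F i t + \sum_(j <- s) F j t)) => [t|].
  by rewrite big_cons.
apply: cvgD; [exact: Fc|exact: ih].
Qed.

Lemma mx_continuous_at (T : topologicalType) m n (f : T -> 'M[R]_(m, n)) x :
  (forall i j, {for x, continuous (fun t => f t i j)}) -> {for x, continuous f}.
Proof.
move=> fc A /nbhs_ballP[e /= e0 eA].
have : \forall t \near x, forall ij : 'I_m * 'I_n, ball (f x ij.1 ij.2) e (f t ij.1 ij.2).
  apply: filter_forall => -[i j] /=.
  by apply: (fc i j); exact: nbhsx_ballx.
apply: filterS => t ft; apply: eA; split => // i j; exact: (ft (i, j)).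
Qed.

Lemma coord_continuous_at (T : topologicalType) m n (f : T -> 'M[R]_(m, n)) x i j :
  {for x, continuous f} -> {for x, continuous (fun t => f t i j)}.
Proof.
move=> fc; apply: (@continuous_comp _ _ _ f (fun M : 'M[R]_(m, n) => M i j)) => //.
exact: coord_continuous.
Qed.

Lemma mulmx_continuous_at (T : topologicalType) m n p (A : 'M[R]_(n, p))
    (f : T -> 'M[R]_(m, n)) x :
  {for x, continuous f} -> {for x, continuous (fun t => f t *m A)}.
Proof.
move=> fc; apply: mx_continuous_at => i j.
apply: (@eq_continuous_at _ _ (fun t => \sum_l f t i l * A l j)) => [t|].
  by rewrite mxE.
apply: sum_continuous_at => l; apply: continuousM; last exact: cst_continuous.
exact: coord_continuous_at.
Qed.

Lemma mulmx_continuous m n p (A : 'M[R]_(n, p)) :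
  continuous (fun y : 'M[R]_(m, n) => y *m A).
Proof. by move=> y; apply: mulmx_continuous_at; exact: cvg_id. Qed.

Lemma dot_continuous_at (T : topologicalType) n (f h : T -> 'rV[R]_n) x :
  {for x, continuous f} -> {for x, continuous h} ->
  {for x, continuous (fun t => dot (f t) (h t))}.
Proof.
move=> fc hc.
apply: (@eq_continuous_at _ _ (fun t => \sum_i f t 0 i * h t 0 i)) => [t|].
  by rewrite dotE.
by apply: sum_continuous_at => i; apply: continuousM; exact: coord_continuous_at.
Qed.

Lemma mform_continuous_at (T : topologicalType) g n (f h : T -> 'rV[R]_n.+1) x :
  {for x, continuous f} -> {for x, continuous h} ->
  {for x, continuous (fun t => mform g (f t) (h t))}.
Proof.
move=> fc hc; rewrite /mform; case: g; try exact: dot_continuous_at.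
apply: continuousB; first exact: dot_continuous_at.
apply: continuousM; first exact: cst_continuous.
by apply: continuousM; exact: coord_continuous_at.
Qed.

Lemma gauge_continuous_at (T : topologicalType) g n (f h : T -> 'rV[R]_n.+1) x :
  {for x, continuous f} -> {for x, continuous h} ->
  {for x, continuous (fun t => gauge g (f t) (h t))}.
Proof.
move=> fc hc; rewrite /gauge; case: g; try exact/continuousN/mform_continuous_at.
by apply: mform_continuous_at; exact: continuousB.
Qed.

End MatrixContinuity.

Section Normalisation.
Context {R : realType} (g : geometry) (n : nat).
Implicit Types x y : 'rV[R]_n.+1.

(** The positive factor by which a vector on the ray of a point of the model
    space has to be divided to recover this point. *)
Definition gnorm y : R :=
  match g with
  | Spherical => Num.sqrt (mform g y y)
  | Euclidean => y 0 0
  | Hyperbolic => Num.sqrt (- mform g y y)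
  end.

Definition normalize y := (gnorm y)^-1 *: y.

(** The vectors on rays of points of the model space. *)
Definition forward y := 0 < gnorm y /\ (g = Hyperbolic -> 0 < y 0 0).

Lemma gnorm_model y : model g y -> gnorm y = 1.
Proof.
rewrite /model /gnorm; case: g => [/= ->|//|[/= -> _]]; rewrite ?opprK; exact: sqrtr1.
Qed.

Lemma model_forward y : model g y -> forward y.
Proof.
move=> my; split; first by rewrite gnorm_model.
by move=> gh; move: my; rewrite gh => -[].
Qed.

Lemma gnormZ a y : 0 <= a -> gnorm (a *: y) = a * gnorm y.
Proof.
move=> a0; rewrite /gnorm; case: g; rewrite ?mxE // !mform_bilin ?mulrA -expr2 -?mulrN.
  by rewrite sqrtrM ?sqr_ge0 // sqrtr_sqr ger0_norm.
by rewrite sqrtrM ?sqr_ge0 // sqrtr_sqr ger0_norm.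
Qed.

Lemma forwardZ a y : 0 < a -> forward y -> forward (a *: y).
Proof.
move=> a0 [y0 yh]; split; first by rewrite gnormZ ?mulr_gt0 ?ltW.
by move=> /yh ?; rewrite mxE mulr_gt0.
Qed.

Lemma forward_neq0 y : forward y -> y != 0.
Proof.
by move=> [y0 _]; apply: contraTneq y0 => ->; rewrite -(scale0r (0 : 'rV[R]_n.+1)) gnormZ // mul0r ltxx.
Qed.

Lemma forward_model y : forward y -> gnorm y = 1 -> model g y.
Proof.
rewrite /forward /gnorm /model; case: g => /= -[y0 yh] y1 //.
- have /ltW s0 : 0 < mform Spherical y y by rewrite -sqrtr_gt0.
  by rewrite -(sqr_sqrtr s0) y1 expr1n.
- split; last exact: yh.
  have /ltW s0 : 0 < - mform Hyperbolic y y by rewrite -sqrtr_gt0.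
  by rewrite -[LHS]opprK -(sqr_sqrtr s0) y1 expr1n.
Qed.

Lemma normalize_model y : model g y -> normalize y = y.
Proof. by move=> /gnorm_model e; rewrite /normalize e invr1 scale1r. Qed.

Lemma normalizeK y : forward y -> gnorm y *: normalize y = y.
Proof. by case=> y0 _; rewrite /normalize scalerA divff ?gt_eqF // scale1r. Qed.

Lemma model_normalize y : forward y -> model g (normalize y).
Proof.
move=> fy; have [y0 _] := fy; apply: forward_model.
  by apply: forwardZ => //; rewrite invr_gt0.
by rewrite gnormZ ?invr_ge0 ?ltW // mulVf ?lt0r_neq0.
Qed.

Lemma gnorm_continuous : continuous gnorm.
Proof.
move=> y; rewrite /gnorm; case: g; last 1 first.
- apply: (@continuous_comp _ _ _ (fun y => - mform _ y y) Num.sqrt); last exact: sqrt_continuous.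
  by apply: continuousN; apply: mform_continuous_at; exact: cvg_id.
- apply: (@continuous_comp _ _ _ (fun y => mform _ y y) Num.sqrt); last exact: sqrt_continuous.
  by apply: mform_continuous_at; exact: cvg_id.
- exact: coord_continuous.
Qed.

Lemma normalize_continuous y : forward y -> {for y, continuous normalize}.
Proof.
move=> [y0 _]; apply: continuousZ; last exact: cvg_id.
by apply: continuousV; [rewrite lt0r_neq0 | exact: gnorm_continuous].
Qed.

Lemma near_forward y : forward y -> \forall z \near y, forward z.
Proof.
move=> [y0 yh]; rewrite /forward.
have : \forall z \near y, 0 < gnorm z.
  by move/cvgr_gt: (@gnorm_continuous y); apply.
have : \forall z \near y, g = Hyperbolic -> 0 < (z : 'rV[R]_n.+1) 0 0.
  case: g yh => yh; try by apply: filterE.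
  have y00 := yh erefl.
  have : \forall z \near y, 0 < (z : 'rV[R]_n.+1) 0 0.
    by move/cvgr_gt: (@coord_continuous R _ _ 0 0 y); apply.
  by apply: filterS.
by apply: filterS2.
Qed.

End Normalisation.

(** * Cones over convex hulls *)

Section Cone.
Context {R : realType} (n k : nat) (V : 'M[R]_(k, n.+1)).
Implicit Types x y : 'rV[R]_n.+1.

Definition cone : set 'rV[R]_n.+1 :=
  [set x | exists2 a : 'rV[R]_k, (forall j, 0 <= a 0 j) & x = a *m V].

Lemma coneD x y : cone x -> cone y -> cone (x + y).
Proof.
move=> [a a0 ->] [b b0 ->]; exists (a + b); last by rewrite mulmxDl.
by move=> j; rewrite mxE addr_ge0.
Qed.

Lemma coneZ a x : 0 <= a -> cone x -> cone (a *: x).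
Proof.
move=> a0 [b b0 ->]; exists (a *: b); last by rewrite -scalemxAl.
by move=> j; rewrite mxE mulr_ge0.
Qed.

Lemma coneZ_iff a x : 0 < a -> cone (a *: x) <-> cone x.
Proof.
move=> a0; split; last exact/coneZ/ltW.
by move=> /(coneZ (ltW (_ : 0 < a^-1))); rewrite scalerK ?lt0r_neq0 //; apply; rewrite invr_gt0.
Qed.

Lemma cone_row i : cone (row i V).
Proof. by exists (delta_mx 0 i) => [j|]; [rewrite mxE ler0n | rewrite -rowE]. Qed.

(** In the hyperbolic case, sums of future timelike vectors are future
    timelike. *)
Lemma forward_cone g x : (forall i, model g (row i V)) -> cone x -> x != 0 ->
  forward g x.
Proof.
move=> mV; case: g mV => mV [a a0 ->] xN0.
- split=> //; rewrite /gnorm sqrtr_gt0 lt_def dot_ge0 andbT.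
  by apply: contra_neq xN0 => /dot_eq0.
- split=> //; rewrite /gnorm mxE.
  have V1 j : V j 0 = 1 by have := mV j; rewrite /model /= mxE.
  under eq_bigr do rewrite V1 mulr1.
  rewrite lt_def sumr_ge0 // andbT psumr_eq0 //; apply: contra_neqN xN0 => /allP az.
  rewrite mulmx_sum_row big1 // => j _.
  by have /eqP -> := az j (mem_index_enum j); rewrite scale0r.
- suff [x0|[x0 xx]] : a *m V = 0 \/
      0 < (a *m V) 0 0 /\ mform Hyperbolic (a *m V) (a *m V) < 0.
    by rewrite x0 eqxx in xN0.
    by split=> //; rewrite /gnorm sqrtr_gt0 oppr_gt0.
  rewrite mulmx_sum_row; elim/big_ind : _ => [|u v [->|[u0 uu]] [->|[v0 vv]]|j _].
  + by left.
  + by rewrite addr0; left.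
  + by rewrite add0r; right.
  + by rewrite addr0; right.
  + right; split; first by rewrite mxE addr_gt0.
    rewrite !mform_bilin (mformC _ v u); have := mform_timelike_lt0 u0 v0 uu vv; lra.
  + have [->|aN0] := eqVneq (a 0 j) 0; first by left; rewrite scale0r.
    have aj : 0 < a 0 j by rewrite lt_def aN0 a0.
    have [vv v0] := mV j; right; split; first by rewrite mxE mulr_gt0.
    by rewrite !mform_bilin vv mulrN1 mulrN oppr_lt0 mulr_gt0.
Qed.

(** A linear form that is positive on the cone outside of [0]. *)
Definition positive_form (u : 'cV[R]_n.+1) := forall i, 0 < (row i V *m u) 0 0.

Variables (u : 'cV[R]_n.+1) (u_gt0 : positive_form u).

Lemma positive_formE (a : 'rV[R]_k) :
  (a *m V *m u) 0 0 = \sum_j a 0 j * (row j V *m u) 0 0.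
Proof. by rewrite -mulmxA mxE; apply: eq_bigr => j _; rewrite -row_mul [in RHS]mxE. Qed.

Lemma positive_form_ge0 x : cone x -> 0 <= (x *m u) 0 0.
Proof.
move=> [a a0 ->]; rewrite positive_formE; apply: sumr_ge0 => j _.
by rewrite mulr_ge0 // ltW.
Qed.

Lemma positive_form_gt0 x : cone x -> x != 0 -> 0 < (x *m u) 0 0.
Proof.
move=> cx; rewrite lt_def positive_form_ge0 // andbT; apply: contra_neqN.
case: cx => a a0 ->; rewrite positive_formE psumr_eq0; last first.
  by move=> j _; rewrite mulr_ge0 // ltW.
move=> /allP az; rewrite mulmx_sum_row big1 // => j _.
have := az j (mem_index_enum j).
by rewrite /= mulf_eq0 (gt_eqF (u_gt0 j)) orbF => /eqP ->; rewrite scale0r.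
Qed.

(** On the cone, a bound on a positive form bounds all the coefficients. *)
Lemma cone_truncation_compact c : exists K : set 'rV[R]_n.+1,
  [/\ compact K, K `<=` cone
    & forall x, cone x -> (x *m u) 0 0 <= c -> K x].
Proof.
pose B := [set a : 'rV[R]_k | forall j,
  `[0, c / (row j V *m u) 0 0]%classic (a ord0 j)].
exists ((fun a : 'rV_k => a *m V) @` B); split.
- apply: continuous_compact.
    by apply: continuous_subspaceT; exact: mulmx_continuous.
  apply: (@rV_compact _ _ (fun j => `[0, c / (row j V *m u) 0 0]%classic)) => j.
  exact: segment_compact.
- move=> _ [a aB <-]; exists a => // j.
  by have := aB j; rewrite /= in_itv /= => /andP[].
- move=> x [a a0 ->]; rewrite positive_formE => le_c; exists a => // j.
  rewrite /= in_itv /= a0 ler_pdivlMr //; apply: le_trans le_c.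
  rewrite (bigD1 j) //= lerDl; apply: sumr_ge0 => i _.
  by rewrite mulr_ge0 // ltW.
Qed.

Lemma form_continuous (l : 'cV[R]_n.+1) : continuous (fun x => (x *m l) 0 0).
Proof.
by move=> x; apply: coord_continuous_at (mulmx_continuous (x:=x)).
Qed.

Lemma near_form_lt (l : 'cV[R]_n.+1) x c : (x *m l) 0 0 < c ->
  \forall y \near x, (y *m l) 0 0 < c.
Proof. by move/cvgr_lt: (@form_continuous l x); apply. Qed.

Lemma near_form_gt (l : 'cV[R]_n.+1) x c : c < (x *m l) 0 0 ->
  \forall y \near x, c < (y *m l) 0 0.
Proof. by move/cvgr_gt: (@form_continuous l x); apply. Qed.

Lemma cone_closed : closed cone.
Proof.
move=> x clx; have [K [Kc KC CK]] := cone_truncation_compact ((x *m u) 0 0 + 1).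
have Kcl : closed K by apply: compact_closed Kc; exact: norm_hausdorff.
apply/KC/Kcl => U Ux.
have := clx (U `&` [set y | (y *m u) 0 0 < (x *m u) 0 0 + 1]).
case; first by apply: filterI => //; apply: near_form_lt; rewrite ltrDl.
by move=> y [cy [Uy yc]]; exists y; split=> //; apply: CK => //; exact: ltW.
Qed.

Lemma hull_normalize g x : (forall i, model g (row i V)) -> cone x -> x != 0 ->
  hull g V (normalize g x).
Proof.
move=> mV cx xN0; have fx := forward_cone mV cx xN0.
split; first exact: model_normalize.
by apply: coneZ => //; rewrite invr_ge0 ltW //; case: fx.
Qed.

(** The central projection maps the compact slice [{u = 1}] of the cone onto the
    hull. *)
Lemma hull_compact g : (forall i, model g (row i V)) -> compact (hull g V).
Proof.
move=> mV; have [K [Kc KC CK]] := cone_truncation_compact 1.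
pose H := [set x : 'rV[R]_n.+1 | (x *m u) 0 0 = 1].
have Hcl : closed H.
  have -> : H = (fun x => (x *m u) 0 0) @^-1` [set 1] by [].
  apply: closed_comp; last exact: closed_eq.
  by move=> x _; exact: form_continuous.
have KHc : compact (K `&` H) by exact: compact_closedI.
have HN0 x : H x -> x != 0.
  by move=> Hx; apply: contra_eq_neq Hx => ->; rewrite mul0mx mxE eq_sym oner_neq0.
have -> : hull g V = (fun x => normalize g x) @` (K `&` H).
  apply/seteqP; split=> [x [mx cx]|_ [x [/KC cx /HN0 xN0] <-]]; last first.
    exact: hull_normalize.
  have xN0 := forward_neq0 (model_forward mx).
  have ux := positive_form_gt0 cx xN0.
  have Hy : H (((x *m u) 0 0)^-1 *: x).
    by rewrite /H /= -scalemxAl mxE mulVf ?lt0r_neq0.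
  exists (((x *m u) 0 0)^-1 *: x).
    split=> //; apply: CK; last by rewrite Hy.
    by apply: coneZ => //; rewrite invr_ge0 ltW.
  rewrite /normalize gnormZ ?invr_ge0 ?(ltW ux) // (gnorm_model mx) mulr1 invrK.
  by rewrite scalerA divff ?lt0r_neq0 // scale1r.
apply: continuous_compact KHc; apply/continuous_in_subspaceT => x.
rewrite inE => -[/KC cx /HN0 xN0].
exact/normalize_continuous/forward_cone.
Qed.

End Cone.

Section PositiveCombinations.
Context {R : realType} (n k : nat) (V : 'M[R]_(k, n.+1)).

(** The rows of [V] in [S], the other ones being replaced by zero. *)
Definition mask_rows (S : {set 'I_k}) := diag_mx (\row_j (j \in S)%:R) *m V.

(** A small perturbation of [a *m V] in the span of the rows in [S] has, through
    [pinvmx], small coefficients on these rows; they can be added to the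
    coefficients of [a], which are positive on [S]. *)
Lemma near_cone (a : 'rV[R]_k) (S : {set 'I_k}) :
  (forall j, 0 <= a 0 j) -> (forall j, (j \in S) = (0 < a 0 j)) ->
  \forall y \near a *m V, (y <= mask_rows S)%MS -> cone V y.
Proof.
move=> a0 aS; pose D := diag_mx (\row_j (j \in S)%:R : 'rV[R]_k).
set W := mask_rows S; have WE : W = D *m V by [].
have aD : a *m D = a.
  apply/rowP => j; rewrite mul_mx_diag !mxE aS.
  by case: ltgtP (a0 j) => //= [|<-] _; rewrite ?mulr1 ?mul0r.
pose b (y : 'rV[R]_n.+1) := a + (y - a *m V) *m pinvmx W *m D.
have bc : {for a *m V, continuous b}.
  have dc : {for a *m V, continuous (fun y : 'rV[R]_n.+1 => y - a *m V)}.
    by apply: continuousB; [exact: cvg_id | exact: cst_continuous].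
  apply: continuousD; first exact: cst_continuous.
  exact/mulmx_continuous_at/mulmx_continuous_at/dc.
have ba : b (a *m V) = a by rewrite /b subrr !mul0mx addr0.
have near_b : \forall y \near a *m V, forall j, 0 <= b y 0 j.
  apply: (@filter_forall _ _ (fun j y => 0 <= b y 0 j) (nbhs (a *m V))) => j.
  case: (ltgtP 0 (a 0 j)) (a0 j) => // [aj|aj] _.
    have bj : {for a *m V, continuous (fun y : 'rV[R]_n.+1 => b y 0 j)}.
      exact: (@coord_continuous_at _ _ _ _ b).
    rewrite -ba in aj; have : \forall y \near a *m V, 0 < b y 0 j.
      by move/cvgr_gt: bj; apply.
    by apply: filterS => y /ltW.
  apply: filterE => y; rewrite /b mul_mx_diag !mxE aS -aj ltxx mulr0 addr0.
  exact: lexx.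
apply: filterS near_b => y by_ge0 yW; exists (b y) => //.
have aW : (a *m V <= W)%MS by rewrite -{1}aD -mulmxA -WE submxMl.
have dW : (y - a *m V <= W)%MS by rewrite addmx_sub // -scaleN1r scalemx_sub.
rewrite /b mulmxDl -(mulmxA _ D V) -WE mulmxKpV //.
by rewrite addrC subrK.
Qed.

End PositiveCombinations.

(** * Interiors of convex hulls *)

Lemma row_full_kernel (F : fieldType) k N (A : 'M[F]_(k, N)) :
  (forall m : 'cV[F]_N, A *m m = 0 -> m = 0) -> row_full A.
Proof.
move=> kerA; have : cokermx A = 0.
  apply/matrixP => i j; have /colP/(_ i) : col j (cokermx A) = 0; last by rewrite !mxE.
  by apply: kerA; rewrite colE mulmxA mulmx_coker mul0mx.
move/eqP; rewrite -mxrank_eq0 mxrank_coker subn_eq0 => le.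
by rewrite /row_full eqn_leq rank_leq_col.
Qed.

Lemma shift_continuous (R : realType) n (v : 'rV[R]_n) :
  continuous (fun y : 'rV[R]_n => y - v).
Proof.
by move=> y; apply: (@continuousB _ _ _ id (cst v)); [exact: cvg_id | exact: cst_continuous].
Qed.

Lemma line_continuous (R : realType) n (v w : 'rV[R]_n) :
  continuous (fun t : R => v + t *: w).
Proof.
by move=> t; apply: cvgD; [exact: cvg_cst | exact: scalel_continuous].
Qed.

Section Interior.
Context {R : realType} (g : geometry) (n k : nat) (V : 'M[R]_(k, n.+1)).
Hypothesis mV : forall i, model g (row i V).
Implicit Types (x y v : 'rV[R]_n.+1) (l : 'cV[R]_n.+1).

(** [x] is interior to the section of the cone by [{l = 0}]. *)
Definition cone_interior l x := \forall y \near x, y *m l = 0 -> cone V y.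

Lemma cone_interior0 x : cone_interior 0 x <-> (cone V)^° x.
Proof.
by split; apply: filterS => y; [move=> Cy; apply: Cy; rewrite mulmx0 | move=> Cy _].
Qed.

Lemma cone_interiorZ l a x : 0 < a -> cone_interior l x -> cone_interior l (a *: x).
Proof.
move=> a0 lx; have ac : {for a *: x, continuous (fun y : 'rV[R]_n.+1 => a^-1 *: y)}.
  exact: scaler_continuous.
have near_y : \forall y \near a *: x, (a^-1 *: y) *m l = 0 -> cone V (a^-1 *: y).
  by apply: (ac (fun y => y *m l = 0 -> cone V y)); rewrite scalerK ?gt_eqF.
apply: filterS near_y => y Cy yl.
have a'0 : 0 < a^-1 by rewrite invr_gt0.
by apply/(coneZ_iff _ _ a'0)/Cy; rewrite -scalemxAl yl scaler0.
Qed.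

Lemma interior_coneD v x : cone V v -> (cone V)^° x -> (cone V)^° (v + x).
Proof.
move=> Cv Cx; have sc : {for v + x, continuous (fun y : 'rV[R]_n.+1 => y - v)}.
  exact: shift_continuous.
have near_y : \forall y \near v + x, cone V (y - v).
  by apply: (sc (cone V)); rewrite addrC addKr.
by apply: filterS near_y => y /coneD/(_ Cv); rewrite subrK.
Qed.

Lemma interior_coneZ a x : 0 < a -> (cone V)^° x -> (cone V)^° (a *: x).
Proof. by move=> a0 /cone_interior0 /(cone_interiorZ a0)/cone_interior0. Qed.

(** The central projection is continuous and moves points along their rays, so
    that interiors can be computed in the cone. *)
Lemma relative_interior_hull l x : model g x -> x *m l = 0 ->
  relative_interior g (hull g V) l x <-> cone_interior l x.
Proof.
move=> mx xl; have fx := model_forward mx; split=> [[Px _ nx]|nx]; last first.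
  have Cx : cone V x by exact: nbhs_singleton nx xl.
  by split=> //; apply: filterS nx => y Cy my yl; split=> //; exact: Cy.
have nc := normalize_continuous fx.
have nyx : \forall y \near x, model g (normalize g y) ->
    normalize g y *m l = 0 -> hull g V (normalize g y).
  apply: (nc (fun y => model g y -> y *m l = 0 -> hull g V y)).
  by rewrite normalize_model.
apply: filterS2 nyx (near_forward fx) => y /= Py fy yl; have [y0 _] := fy.
have [_ Cn] : hull g V (normalize g y).
  by apply: Py; [exact: model_normalize | rewrite -scalemxAl yl scaler0].
have y'0 : 0 < (gnorm g y)^-1 by rewrite invr_gt0.
exact/(coneZ_iff V y y'0).
Qed.

Lemma open_hull x :
  open_polyhedron g (hull g V) x <-> model g x /\ (cone V)^° x.
Proof.
split=> [ox|[mx Cx]].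
  have [[mx _] _ _] := ox; split=> //; apply/cone_interior0.
  by apply/relative_interior_hull => //; rewrite mulmx0.
by apply/relative_interior_hull => //; [rewrite mulmx0 | apply/cone_interior0].
Qed.

Hypothesis fV : row_full V.
Variables (u : 'cV[R]_n.+1) (u_gt0 : positive_form V u).

Lemma rows_inhabited : exists j : 'I_k, True.
Proof.
case: k V fV => [|k'] W; last by exists ord0.
by rewrite /row_full flatmx0 mxrank0.
Qed.

Definition cone_center : 'rV[R]_n.+1 := const_mx 1 *m V.

Lemma interior_cone_center : (cone V)^° cone_center.
Proof.
have mask : mask_rows V [set: 'I_k]%SET = V.
  rewrite /mask_rows (_ : \row_j _ = const_mx 1) ?diag_const_mx ?mul1mx //.
  by apply/rowP => j; rewrite !mxE inE.
have := @near_cone _ _ _ V (const_mx 1) [set: 'I_k]%SET; rewrite mask => near_c.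
apply: filterS (near_c _ _) => [y|j|j]; first by apply; exact: submx_full.
  by rewrite mxE.
by rewrite mxE ltr01 inE.
Qed.

Lemma form_cone_center : 0 < (cone_center *m u) 0 0.
Proof.
rewrite positive_formE; have [j _] := rows_inhabited.
have c1 i : (const_mx 1 : 'rV[R]_k) 0 i = 1 by rewrite mxE.
rewrite (bigD1 j) //= c1 mul1r ltr_pwDl //.
by apply: sumr_ge0 => i _; rewrite c1 mul1r ltW.
Qed.

Lemma forward_form x : cone V x -> 0 < (x *m u) 0 0 -> forward g x.
Proof.
move=> Cx ux; apply: forward_cone Cx _ => //.
by apply: contraTneq ux => ->; rewrite mul0mx mxE ltxx.
Qed.

Lemma open_normalize x : (cone V)^° x -> forward g x ->
  open_polyhedron g (hull g V) (normalize g x).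
Proof.
move=> Cx fx; apply/open_hull; split; first exact: model_normalize.
by apply: interior_coneZ => //; rewrite invr_gt0; case: fx.
Qed.

(** Every point of the hull can be moved towards the center. *)
Lemma open_hull_dense v U : hull g V v -> nbhs v U ->
  exists2 y, open_polyhedron g (hull g V) y & U y.
Proof.
move=> [mv Cv] Uv; have fv := model_forward mv.
pose c (t : R) := v + t *: cone_center.
have cc : {for 0, continuous c} by exact: line_continuous.
have c0 : c 0 = v by rewrite /c scale0r addr0.
have : {for 0, continuous (fun t => normalize g (c t))}.
  apply: (@continuous_comp _ _ _ c (fun y => normalize g y)); first exact: cc.
  by rewrite c0; exact: normalize_continuous.
move=> nc; have Uc : \forall t \near (0 : R), U (normalize g (c t)).
  by apply: nc; rewrite /= c0 normalize_model.
have [t [/= Ut t0]] : exists t, U (normalize g (c t)) /\ 0 < t.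
  have := @filter_ex _ (0 : R)^'+ _ [set t | U (normalize g (c t)) /\ 0 < t].
  apply; apply: filterI; last exact: nbhs_right_gt.
  exact: cvg_within Uc.
exists (normalize g (c t)) => //; apply: open_normalize.
  by apply: interior_coneD => //; apply: interior_coneZ => //; exact: interior_cone_center.
apply: forward_form.
  apply: coneD => //; apply: coneZ (ltW t0) _.
  exact: nbhs_singleton interior_cone_center.
rewrite mulmxDl -scalemxAl mxE addrC ltr_pwDl //.
  by rewrite mxE mulr_gt0 // form_cone_center.
exact: positive_form_ge0.
Qed.

(** The points [cone_center + row i V] of the rays are interior. A linear form
    that vanishes at all of them takes the opposite of its value at the center
    at each row, and the center is the sum of the rows; so this value is [0]. *)
Lemma open_hull_spanning : exists Y : 'M[R]_(k, n.+1),
  row_full Y /\ forall i, open_polyhedron g (hull g V) (row i Y).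
Proof.
pose y i := cone_center + row i V.
have Cc : cone V cone_center by exact: nbhs_singleton interior_cone_center.
have Cy i : (cone V)^° (y i).
  by rewrite /y addrC; apply: interior_coneD interior_cone_center; exact: cone_row.
have fy i : forward g (y i).
  apply: forward_form; first by apply: coneD => //; exact: cone_row.
  by rewrite mulmxDl mxE addr_gt0 ?form_cone_center.
exists (\matrix_i normalize g (y i)); split; last first.
  by move=> i; rewrite rowK; exact: open_normalize.
apply: row_full_kernel => m Ym.
have ym i : (y i *m m) 0 0 = 0.
  have /rowP/(_ 0) : row i ((\matrix_i normalize g (y i)) *m m) = 0.
    by rewrite Ym row0.
  rewrite row_mul rowK /normalize -scalemxAl !mxE => /eqP.
  by rewrite mulf_eq0 invr_eq0 gt_eqF ?(proj1 (fy i)) //= => /eqP.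
have Vm i : (row i V *m m) 0 0 = - (cone_center *m m) 0 0.
  by apply/eqP; rewrite -addr_eq0 addrC; have := ym i; rewrite mulmxDl mxE => ->.
have cm : (cone_center *m m) 0 0 = 0.
  have : (cone_center *m m) 0 0 = \sum_(j < k) - (cone_center *m m) 0 0.
    by rewrite [LHS]positive_formE; apply: eq_bigr => j _; rewrite [X in X * _]mxE mul1r Vm.
  rewrite sumr_const card_ord => /eqP.
  rewrite -subr_eq0 mulNrn opprK -mulrS mulrn_eq0 /= => /eqP; exact.
have : V *m m = 0.
  apply/colP => i; rewrite [RHS]mxE; have := Vm i.
  by rewrite cm oppr0 -row_mul [in X in X = _ -> _]mxE.
move=> /(congr1 (mulmx (pinvmx V))); rewrite mulmxA mulmx0.
by have := mulVpmx fV => ->; rewrite mul1mx.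
Qed.

End Interior.

(** * Segments in a polyhedron *)

Section Rays.
Context {R : realType} (g : geometry) (n k : nat) (V : 'M[R]_(k, n.+1)).
Hypotheses (mV : forall i, model g (row i V)) (fV : row_full V).
Variables (u : 'cV[R]_n.+1) (u_gt0 : positive_form V u).
Implicit Types (x y v : 'rV[R]_n.+1) (l : 'cV[R]_n.+1).

(** The points other than [v] of the segment from [v] to [y0] are interior, and
    by the intermediate value theorem one of them has distance [r] from [v]. *)
Lemma hull_geodesic_point v y0 r : hull g V v ->
    open_polyhedron g (hull g V) y0 -> 0 < r <= mdist g v y0 ->
  exists s t, [/\ 0 <= s, 0 < t,
    open_polyhedron g (hull g V) (s *: v + t *: y0)
    & mdist g v (s *: v + t *: y0) = r].
Proof.
move=> Pv oy /andP[r0 ry]; have [my Iy] := (open_hull g V y0).1 oy.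
have Cy : cone V y0 := nbhs_singleton Iy.
have [mv _] := Pv; have Cv : cone V v by case: Pv.
have [range0 range1] := mdist_range mv my.
have rr : dist_range g r.
  by split; [exact: ltW | move=> /range1; exact: le_trans].
pose w (t : R) := v + t *: (y0 - v).
have wE t : w t = (1 - t) *: v + t *: y0.
  by apply/rowP => j; rewrite !mxE; ring.
have Cw t : 0 <= t <= 1 -> cone V (w t).
  by move=> /andP[t0 t1]; rewrite wE; apply: coneD; apply: coneZ; rewrite ?subr_ge0.
have fw t : 0 <= t <= 1 -> forward g (w t).
  move=> t01; apply: (forward_form mV (u := u) (Cw t t01)); rewrite wE mulmxDl -!scalemxAl.
  have uv := positive_form_gt0 u_gt0 Cv (forward_neq0 (model_forward mv)).
  have uy := positive_form_gt0 u_gt0 Cy (forward_neq0 (model_forward my)).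
  case/andP: t01 => t0 t1; rewrite mxE [X in X + _]mxE [X in _ + X]mxE.
  have [->|tN0] := eqVneq t 0; first by rewrite mul0r addr0 subr0 mul1r.
  apply: ltr_wpDl; first by rewrite mulr_ge0 ?subr_ge0 // ltW.
  by rewrite mulr_gt0 // lt_def tN0.
pose f (t : R) := gauge g v (normalize g (w t)).
have f0 : f 0 = gauge_min g.
  rewrite /f /w scale0r addr0 normalize_model //.
  by have [_] := gauge_ge mv mv; rewrite eqxx => /eqP/esym.
have f1 : f 1 = gauge g v y0.
  by rewrite /f wE subrr scale0r add0r scale1r normalize_model.
have fc : {within `[0, 1], continuous f}.
  apply/continuous_in_subspaceT => t; rewrite inE /= in_itv /= => t01.
  apply: (@gauge_continuous_at _ _ _ _ (cst v) (fun t => normalize g (w t))).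
    exact: cst_continuous.
  apply: (@continuous_comp _ _ _ w (fun y => normalize g y)).
    exact: line_continuous.
  exact/normalize_continuous/fw.
have le01 : (0 : R) <= 1 by [].
have le r1 r2 : dist_range g r2 -> 0 <= r1 <= r2 ->
    gauge_of_dist g r1 <= gauge_of_dist g r2 by exact: ler_gauge_of_dist.
have /(IVT le01 fc)[t] : Order.min (f 0) (f 1) <= gauge_of_dist g r <= Order.max (f 0) (f 1).
  rewrite f0 f1 -(gauge_of_mdist mv my) -gauge_of_dist0.
  have h : gauge_of_dist g 0 <= gauge_of_dist g (mdist g v y0).
    by apply: le => //; rewrite range0 lexx.
  rewrite min_l // max_r //; apply/andP; split; apply: le => //.
    by rewrite lexx ltW.
  by rewrite ltW.
rewrite in_itv /= => t01 ft; have [t0 t1] := andP t01.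
have tN0 : t != 0.
  apply: contraTneq r0 => tz; rewrite -leNgt.
  rewrite -(gauge_of_distK rr) -ft tz f0 -gauge_of_dist0 gauge_of_distK //.
  by split=> // _; exact: pi_ge0.
have {}t0 : 0 < t by rewrite lt_def tN0.
have [gw _] := fw t t01.
have nE : ((gnorm g (w t))^-1 * (1 - t)) *: v + ((gnorm g (w t))^-1 * t) *: y0 =
    normalize g (w t) by rewrite /normalize wE scalerDr !scalerA.
exists ((gnorm g (w t))^-1 * (1 - t)), ((gnorm g (w t))^-1 * t); split.
- by rewrite mulr_ge0 ?invr_ge0 ?subr_ge0 // ltW.
- by rewrite mulr_gt0 ?invr_gt0.
- rewrite nE; apply: open_normalize => //; last exact: fw.
  rewrite wE; apply: interior_coneD; last exact: interior_coneZ.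
  by apply: coneZ => //; rewrite subr_ge0.
- by rewrite nE mdistE -/(f t) ft gauge_of_distK.
Qed.

(** The last point of a segment in the cone, which is closed. *)
Lemma cone_exit a w : cone V a -> ~ cone V w ->
  exists t, let z := a + t *: (w - a) in
    [/\ 0 <= t < 1, cone V z & ~ (cone V)^° z].
Proof.
move=> Ca Cw; pose z (t : R) := a + t *: (w - a).
have z0 : z 0 = a by rewrite /z scale0r addr0.
have z1 : z 1 = w by rewrite /z scale1r addrC subrK.
pose E := [set t | 0 <= t <= 1 /\ cone V (z t)].
have E0 : E 0 by split; rewrite ?z0 ?lexx ?ler01.
have Eub : ubound E 1 by move=> t [/andP[_ t1] _].
have En0 : E !=set0 by exists 0.
have Eub' : has_ubound E by exists 1.
have s0 : 0 <= sup E by exact: ub_le_sup.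
have s1 : sup E <= 1 by exact: ge_sup.
have zc : {for sup E, continuous z} by exact: line_continuous.
have Cs : cone V (z (sup E)).
  apply: (cone_closed u_gt0) => U /zc Us.
  have [t [[_ Ct] Ut]] := closure_sup En0 Eub' Us.
  by exists (z t).
have s_lt1 : sup E < 1.
  by rewrite lt_def s1 andbT; apply/eqP => e; apply: Cw; rewrite -z1 e.
exists (sup E); split=> //; first by rewrite s0.
move=> Is; have Us : \forall t \near sup E, cone V (z t).
  exact: zc Is.
have [t [[Ct t1] ts]] : exists t, (cone V (z t) /\ t < 1) /\ sup E < t.
  apply: (@filter_ex _ (sup E)^'+ _).
  apply: filterI; last exact: nbhs_right_gt.
  by apply: filterI; [exact: cvg_within Us | exact: nbhs_right_lt].
have : t <= sup E.
  apply: ub_le_sup => //.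
  by split=> //; rewrite (le_trans s0 (ltW ts)) (ltW t1).
by rewrite leNgt ts.
Qed.

Lemma segment_zero_coord (t c e y : R) : t != 0 ->
  y + t * (e - c * y - y) = 0 -> e = (c + 1 - t^-1) * y.
Proof.
move=> tN0 h; apply: (mulfI tN0); apply/eqP; rewrite -subr_eq0 -h; apply/eqP.
by field.
Qed.

(** A segment from an interior point to a point where the positive form is
    negative leaves the cone at a boundary point. The end is chosen off the line
    of the interior point, for the segment to miss [0]. *)
Lemma hull_boundary_neq0 : (0 < n)%N ->
  exists2 y, hull g V y & ~ open_polyhedron g (hull g V) y.
Proof.
move=> n0; have [x Cx ux] : exists2 x, cone V x & 0 < (x *m u) 0 0.
  exists (cone_center V); last exact: form_cone_center.
  exact: nbhs_singleton (interior_cone_center fV).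
have [i xi] : exists i : 'I_n.+1, ~~ (row i 1%:M <= x)%MS.
  apply/existsP; apply: contraT; rewrite negb_exists => /forallP all_i.
  have /mxrankS : (1%:M <= x)%MS.
    by apply/row_subP => i; have := all_i i; rewrite negbK.
  rewrite mxrank1 => /leq_trans/(_ (rank_leq_row x)).
  by rewrite ltnS leqNgt n0.
pose c := `|(row i 1%:M *m u) 0 0| / (x *m u) 0 0 + 1.
pose w := row i 1%:M - c *: x.
have uw : (w *m u) 0 0 < 0.
  have -> : (w *m u) 0 0 = (row i 1%:M *m u) 0 0 - c * (x *m u) 0 0.
    by rewrite mulmxBl -scalemxAl !mxE.
  rewrite subr_lt0 /c mulrDl mul1r divfK ?gt_eqF //.
  by rewrite (le_lt_trans (ler_norm _)) // ltrDl.
have Cw : ~ cone V w by move=> /(positive_form_ge0 u_gt0); rewrite leNgt uw.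
have [t []] := cone_exit Cx Cw; set z := x + _ => t01 Cz Iz.
have zN0 : z != 0.
  apply: contraNneq xi => zE.
  have [tE|tN0] := eqVneq t 0.
    by move: zE ux; rewrite /z tE scale0r addr0 => ->; rewrite mul0mx mxE ltxx.
  have -> : row i 1%:M = (c + 1 - t^-1) *: x.
    apply/rowP => j; rewrite [RHS]mxE.
    apply: (segment_zero_coord tN0); transitivity (z 0 j); last by rewrite zE mxE.
    rewrite /z /w.
    by rewrite !mxE.
  exact: scalemx_sub.
have fz : forward g z := forward_cone mV Cz zN0.
exists (normalize g z); first exact: hull_normalize.
move=> /(open_hull g V)[_ Inz]; apply: Iz.
have [gz _] := fz; rewrite -(normalizeK fz); exact: interior_coneZ.
Qed.

End Rays.

(** * Facets *)

Section GenericPoints.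
Context {R : realType} (n : nat).
Implicit Types (w : 'rV[R]_n) (m : 'cV[R]_n).

Lemma line_near w d (U : set 'rV[R]_n) : nbhs w U ->
  \forall t \near (0 : R)^'+, U (w + t *: d).
Proof.
move=> Uw; have := @line_continuous R n w d 0; rewrite /continuous_at scale0r addr0.
by move=> lc; apply: cvg_within; exact: lc.
Qed.

(** One hyperplane at a time: a nonempty open set contains a nonempty open set
    off the hyperplane. *)
Lemma avoid_hyperplanes (s : seq 'cV[R]_n) w (U : set 'rV[R]_n) :
  0 \notin s -> nbhs w U ->
  exists2 w', U w' & forall m, m \in s -> (w' *m m) 0 0 != 0.
Proof.
elim: s w U => [|m s ih] w U; first by move=> _ /nbhs_singleton Uw; exists w.
rewrite inE negb_or eq_sym => /andP[mN0 sN0] Uw.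
have mc : continuous (fun x : 'rV[R]_n => (x *m m) 0 0).
  by move=> x; apply: coord_continuous_at (mulmx_continuous (x:=x)).
have near_neq (x : 'rV[R]_n) : (x *m m) 0 0 != 0 -> \forall y \near x, (y *m m) 0 0 != 0.
  by move=> xm; move/cvgr_neq0: (mc x); apply.
have [x Ux xm] : exists2 x : 'rV[R]_n, nbhs x U & (x *m m) 0 0 != 0.
  have [wm|wm] := eqVneq ((w *m m) 0 0) 0; last by exists w.
  have mm : (m^T *m m) 0 0 != 0.
    apply: contra_neq mN0 => mm0; apply: trmx_inj; rewrite trmx0.
    by apply: dot_eq0; rewrite /dot trmxK.
  have := filter_ex (filterI (line_near m^T (nbhs_interior Uw)) (nbhs_right_gt 0)).
  move=> [t [Ut t0]]; exists (w + t *: m^T) => //.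
  have -> : ((w + t *: m^T) *m m) 0 0 = t * (m^T *m m) 0 0.
    by rewrite mulmxDl -scalemxAl [LHS]mxE wm add0r [LHS]mxE.
  by rewrite mulf_neq0 // gt_eqF.
have [w' [Uw' w'm] w's] := ih x (U `&` [set y | (y *m m) 0 0 != 0]) sN0
  (filterI Ux (near_neq x xm)).
exists w' => // m'; rewrite inE => /predU1P[->|m's]; first exact: w'm.
exact: w's.
Qed.

End GenericPoints.

Section Facets.
Context {R : realType} (g : geometry) (n k : nat) (V : 'M[R]_(k, n.+1)).
Hypotheses (mV : forall i, model g (row i V)) (fV : row_full V).
Variables (u : 'cV[R]_n.+1) (u_gt0 : positive_form V u).
Implicit Types (x y z : 'rV[R]_n.+1) (l : 'cV[R]_n.+1).

Lemma rank_deficient_kernel p (A : 'M[R]_(p, n.+1)) : (\rank A <= n)%N ->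
  exists2 m : 'cV[R]_n.+1, m != 0 & A *m m = 0.
Proof.
move=> rA; have : cokermx A != 0.
  by rewrite -mxrank_eq0 mxrank_coker -lt0n subn_gt0.
move=> cN0; have [j jN0] : exists j, col j (cokermx A) != 0.
  apply/existsP; apply: contraNT cN0; rewrite negb_exists => /forallP c0.
  apply/eqP/matrixP => i j; have := c0 j; rewrite negbK => /eqP/colP/(_ i).
  by rewrite !mxE.
by exists (col j (cokermx A)) => //; rewrite colE mulmxA mulmx_coker mul0mx.
Qed.

(** A point near [z] is a point near [z] of the hyperplane [{l = 0}], which lies
    in the cone, plus a positive multiple of whichever of the rows [i] and [j] is
    on its side of the hyperplane. *)
Lemma cone_interior_two_sided l z i j :
  cone_interior V l z -> z *m l = 0 ->
  0 < (row i V *m l) 0 0 -> (row j V *m l) 0 0 < 0 -> (cone V)^° z.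
Proof.
move=> Iz zl il jl.
pose psi i y := y - y *m (l *m (((row i V *m l) 0 0)^-1 *: row i V)).
have psiE i' y : y = psi i' y + ((y *m l) 0 0 / (row i' V *m l) 0 0) *: row i' V.
  rewrite -scalerA -mul_scalar_mx -mx11_scalar /psi mulmxA subrK //.
have near_psi i' : (row i' V *m l) 0 0 != 0 -> \forall y \near z, cone V (psi i' y).
  move=> lN0; have psic : {for z, continuous (psi i')}.
    apply: (@continuousB _ _ _ id (mulmx^~ (l *m (((row i' V *m l) 0 0)^-1 *: row i' V)))).
      exact: cvg_id.
    exact: mulmx_continuous.
  have psiz : psi i' z = z by rewrite /psi mulmxA zl mul0mx subr0.
  have near_l : \forall y \near z, psi i' y *m l = 0 -> cone V (psi i' y).
    by apply: (psic (fun y => y *m l = 0 -> cone V y)); rewrite psiz.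
  apply: filterS near_l => y; apply; rewrite mulmxBl -!mulmxA -scalemxAl.
  have -> : ((row i' V *m l) 0 0)^-1 *: (row i' V *m l) = 1%:M.
    by apply/rowP => c; rewrite ord1 [LHS]mxE mulVf // mxE eqxx.
  by rewrite mulmx1 subrr.
have iN0 : (row i V *m l) 0 0 != 0 by rewrite gt_eqF.
have jN0 : (row j V *m l) 0 0 != 0 by rewrite lt_eqF.
apply: filterS2 (near_psi i iN0) (near_psi j jN0) => y Ci Cj.
have [yl|yl] := lerP 0 ((y *m l) 0 0).
  by rewrite (psiE i y); apply: coneD Ci (coneZ _ (cone_row V i)); rewrite divr_ge0 // ltW.
rewrite (psiE j y); apply: coneD Cj (coneZ _ (cone_row V j)).
by rewrite -mulrNN mulr_ge0 ?oppr_ge0 ?invr_le0 // ltW.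
Qed.

(** Near a boundary point there are an interior point [a] and a point outside of
    the cone. When the second one is generic, the segment between them leaves the
    cone at a point [z] that is a positive combination of rows that span a
    hyperplane: not the whole space, because [z] would be interior, and not a
    smaller subspace, because the segment avoids the finitely many ones. This
    hyperplane supports the cone, because otherwise [z] would again be
    interior. *)
Lemma cone_facet y U : cone V y -> ~ (cone V)^° y -> nbhs y U ->
  exists z l, [/\ U z, l != 0, forall x, cone V x -> 0 <= (x *m l) 0 0,
    z *m l = 0 & cone_interior V l z].
Proof.
move=> Cy Iy /nbhs_ballP[e /= e0 eU].
have By : nbhs y (ball y e) by exact: nbhsx_ballx.
have [a [Ba Ia]] : exists a, ball y e a /\ (cone V)^° a.
  have := filter_ex (filterI (line_near (cone_center V) By) (nbhs_right_gt 0)).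
  move=> [t [Bt t0]]; exists (y + t *: cone_center V); split=> //.
  by apply: interior_coneD => //; apply: interior_coneZ => //; exact: interior_cone_center.
have [w0 Bw0 Cw0] : exists2 w, ball y e w & ~ cone V w.
  apply: contrapT => no; apply: Iy; apply: filterS By => w Bw.
  by apply: contrapT => Cw; apply: no; exists w.
have nW : nbhs w0 (ball y e `&` ~` cone V).
  apply: filterI; first by apply: open_nbhs_nbhs; split=> //; exact: ball_open.
  by apply: open_nbhs_nbhs; split=> //; apply: closed_openC; exact: cone_closed u_gt0.
(* [m J] vanishes at [a] and at the rows in [J], if these have rank below [n]:
   a segment from [a] that ends off [{m J = 0}] avoids the span of the rows. *)
have /choice[m hm] : forall J : {set 'I_k}, exists m : 'cV[R]_n.+1, m != 0 /\
    ((\rank (mask_rows V J) < n)%N -> a *m m = 0 /\ mask_rows V J *m m = 0).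
  move=> J; have [rS|rS] := ltnP (\rank (mask_rows V J)) n; last first.
    exists (const_mx 1); split=> //; apply/eqP => /colP/(_ 0)/eqP.
    by rewrite !mxE oner_eq0.
  have [|m mN0] := @rank_deficient_kernel _ (col_mx a (mask_rows V J)).
    rewrite -addsmxE (leq_trans (mxrank_adds_leqif _ _).1) //.
    by rewrite (leq_trans (leq_add (rank_leq_row a) (leqnn _))).
  rewrite mul_col_mx -col_mx0 => /eq_col_mx[am Sm].
  by exists m.
have sN0 : 0 \notin [seq m J | J <- enum {set 'I_k}].
  by apply/negP => /mapP[J _ /esym/eqP]; apply/negP; case: (hm J).
have [w [Bw Cw] wm] := avoid_hyperplanes sN0 nW.
have {}wm J : (w *m m J) 0 0 != 0 by apply/wm/map_f; rewrite mem_enum.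
have [t []] := cone_exit u_gt0 (nbhs_singleton Ia) Cw; set z := a + _ => t01 Cz Iz.
have tN0 : t != 0.
  by apply: contra_notN Iz => /eqP tE; rewrite /z tE scale0r addr0.
have Uz : U z.
  apply: eU; move: Ba Bw; rewrite -!ball_normE /= => Ba Bw.
  have -> : y - z = (1 - t) *: (y - a) + t *: (y - w).
    by apply/rowP => j; rewrite !mxE; ring.
  case/andP: t01 => t0 t1; rewrite (le_lt_trans (ler_normD _ _)) // !normrZ.
  rewrite (ger0_norm t0) ger0_norm ?subr_ge0 ?ltW //.
  have -> : e = (1 - t) * e + t * e by ring.
  by rewrite ltrD // ltr_pM2l // ?subr_gt0 // lt_def tN0.
have [b b0 zE] := Cz; pose J := [set j | 0 < b 0 j]%SET.
have zS : \forall x \near z, (x <= mask_rows V J)%MS -> cone V x.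
  by rewrite zE; apply: near_cone => // j; rewrite inE.
have zW : (z <= mask_rows V J)%MS.
  rewrite zE (_ : b = b *m diag_mx (\row_j (j \in J)%:R)) ?mulmxA -?mulmxA ?submxMl //.
  apply/rowP => j; rewrite mul_mx_diag !mxE inE.
  by case: ltgtP (b0 j) => //= [|<-] _; rewrite ?mulr1 ?mul0r.
have rS : \rank (mask_rows V J) = n.
  apply/eqP; rewrite eqn_leq; apply/andP; split.
    rewrite leqNgt; apply: contra_notN Iz => rS; apply: filterS zS => x; apply.
    by apply: submx_full; rewrite /row_full eqn_leq rank_leq_col.
  rewrite leqNgt; apply/negP => /(hm J).2[am Sm].
  have /eqP := wm J; apply.
  have : z *m m J = 0.
    by have /submxP[D ->] := zW; rewrite -mulmxA Sm mulmx0.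
  rewrite /z mulmxDl -scalemxAl mulmxBl am subr0 add0r => /eqP.
  by rewrite scaler_eq0 (negPf tN0) /= => /eqP ->; rewrite mxE.
have [l lN0 Wl] : exists2 l : 'cV[R]_n.+1, l != 0 & mask_rows V J *m l = 0.
  by apply: rank_deficient_kernel; rewrite rS.
have Il : cone_interior V l z.
  apply: filterS zS => x Cx xl; apply: Cx.
  have Wk : (mask_rows V J <= kermx l)%MS by apply/sub_kermxP.
  have /mxrank_leqif_sup/leqifP := Wk.
  have rl : \rank l = 1%N.
    by apply/eqP; rewrite eqn_leq rank_leq_col lt0n mxrank_eq0.
  rewrite rS mxrank_ker rl subSS subn0; case: ifP => [kW _|_]; last by rewrite ltnn.
  by apply: submx_trans kW; apply/sub_kermxP.
have zl : z *m l = 0 by have /submxP[D ->] := zW; rewrite -mulmxA Wl mulmx0.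
have sign : (forall i, 0 <= (row i V *m l) 0 0) \/ (forall i, (row i V *m l) 0 0 <= 0).
  have [|/existsNP[j /negP]] := pselect (forall i, 0 <= (row i V *m l) 0 0).
    by left.
  rewrite -ltNge => jl; right => i; rewrite leNgt; apply/negP => il.
  exact/Iz/(cone_interior_two_sided Il zl il jl).
have nonneg l' : (forall i, 0 <= (row i V *m l') 0 0) ->
    forall x, cone V x -> 0 <= (x *m l') 0 0.
  move=> l'0 _ [c c0 ->]; rewrite positive_formE; apply: sumr_ge0 => i _.
  by rewrite mulr_ge0.
case: sign => [l_ge0|l_le0]; first by exists z, l; split=> //; exact: nonneg.
exists z, (- l); split=> //; first by rewrite oppr_eq0.
- by apply: nonneg => i; rewrite mulmxN mxE oppr_ge0.
- by rewrite mulmxN zl oppr0.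
- by apply: filterS Il => x Cx; rewrite mulmxN => /eqP; rewrite oppr_eq0 => /eqP /Cx.
Qed.

(** Open facets are dense in the boundary. *)
Lemma hull_facet y U : hull g V y -> ~ open_polyhedron g (hull g V) y ->
    nbhs y U ->
  exists z l, [/\ U z, defines_facet g (hull g V) l
    & relative_interior g (hull g V) l z].
Proof.
move=> [my Cy] oy Uy; have fy := model_forward my.
have Iy : ~ (cone V)^° y by move=> Iy; apply/oy/open_hull.
have nU : nbhs y [set x | forward g x /\ U (normalize g x)].
  apply: filterI; first exact: near_forward.
  by apply: (normalize_continuous fy); rewrite normalize_model.
have [z [l [[fz Uz] lN0 l0 zl Iz]]] := cone_facet Cy Iy nU.
have [gz _] := fz; have gz' : 0 < (gnorm g z)^-1 by rewrite invr_gt0.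
have rz : relative_interior g (hull g V) l (normalize g z).
  apply/relative_interior_hull; first exact: model_normalize.
    by rewrite -scalemxAl zl scaler0.
  exact: cone_interiorZ.
exists (normalize g z), l; split=> //; split=> //; last by exists (normalize g z).
by move=> x [_ /l0].
Qed.

End Facets.

(** * Convex polyhedra *)

Section Polyhedra.
Context {R : realType} (g : geometry) (n : nat) (P : set 'rV[R]_n.+1).
Hypothesis polP : convex_polyhedron g P.
Implicit Types (x y v : 'rV[R]_n.+1) (l : 'cV[R]_n.+1).

Lemma polyhedron_generators : exists k (V : 'M[R]_(k, n.+1)) (u : 'cV[R]_n.+1),
  [/\ forall i, model g (row i V), row_full V, positive_form V u & P = hull g V].
Proof.
case: polP => k [V [mV fV hemi ->]]; exists k, V.
case: g mV hemi => mV hemi.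
- have [u u0] := hemi erefl; exists u^T; split=> // i.
  by have := u0 i; rewrite dotC.
- exists (delta_mx 0 0); split=> // i; rewrite -colE mxE.
  by have -> : row i V 0 0 = 1 by exact: mV.
- exists (delta_mx 0 0); split=> // i; rewrite -colE mxE.
  by have [] := mV i.
Qed.

Lemma polyhedron_model y : P y -> model g y.
Proof. by have [k [V [u [_ _ _ ->]]]] := polyhedron_generators; case. Qed.

Lemma polyhedron_compact : compact P.
Proof.
by have [k [V [u [mV _ u0 ->]]]] := polyhedron_generators; exact: (hull_compact u0 mV).
Qed.

Lemma polyhedron_closed : closed P.
Proof. by apply: compact_closed polyhedron_compact; exact: norm_hausdorff. Qed.

Lemma open_polyhedron_sub : open_polyhedron g P `<=` P.
Proof. by move=> y []. Qed.

Lemma open_polyhedron_dense v U : P v -> nbhs v U ->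
  exists2 y, open_polyhedron g P y & U y.
Proof.
have [k [V [u [mV fV u0 ->]]]] := polyhedron_generators.
exact: open_hull_dense u0 _ _.
Qed.

Lemma open_polyhedron_spanning : exists k (Y : 'M[R]_(k, n.+1)),
  row_full Y /\ forall i, open_polyhedron g P (row i Y).
Proof.
have [k [V [u [mV fV u0 ->]]]] := polyhedron_generators.
by exists k; exact: open_hull_spanning u0.
Qed.

Lemma open_polyhedron_neq0 : open_polyhedron g P !=set0.
Proof.
have [k [Y [fY oY]]] := open_polyhedron_spanning.
by have [j _] := rows_inhabited fY; exists (row j Y).
Qed.

Lemma polyhedron_geodesic_point v y0 r : P v ->
    open_polyhedron g P y0 -> 0 < r <= mdist g v y0 ->
  exists s t, [/\ 0 <= s, 0 < t, open_polyhedron g P (s *: v + t *: y0)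
    & mdist g v (s *: v + t *: y0) = r].
Proof.
have [k [V [u [mV fV u0 ->]]]] := polyhedron_generators.
exact: hull_geodesic_point u0 _ _ _.
Qed.

Lemma polyhedron_boundary_neq0 : (0 < n)%N ->
  exists2 y, P y & ~ open_polyhedron g P y.
Proof.
have [k [V [u [mV fV u0 ->]]]] := polyhedron_generators.
exact: hull_boundary_neq0 u0.
Qed.

Lemma polyhedron_facet y U : P y -> ~ open_polyhedron g P y -> nbhs y U ->
  exists z l, [/\ U z, defines_facet g P l & relative_interior g P l z].
Proof.
have [k [V [u [mV fV u0 ->]]]] := polyhedron_generators.
exact: hull_facet u0 _ _.
Qed.

End Polyhedra.

Lemma polyhedron_dim0 {R : realType} g (P : set 'rV[R]_1) x y :
  convex_polyhedron g P -> P x -> P y -> x = y.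
Proof.
move=> polP; have [k [V [u [mV fV u0 ->]]]] := polyhedron_generators polP.
move=> [mx Cx] [my Cy].
have xN0 := forward_neq0 (model_forward mx).
have ux := positive_form_gt0 u0 Cx xN0.
have uy := positive_form_gt0 u0 Cy (forward_neq0 (model_forward my)).
have x0 : x 0 0 != 0.
  by apply: contra_neq xN0 => x0; apply/rowP => i; rewrite ord1 x0 mxE.
have [a yx] : exists a, y = a *: x.
  exists (y 0 0 / x 0 0).
  by apply/rowP => i; rewrite ord1 [RHS]mxE divfK.
have a0 : 0 < a.
  by move: uy; rewrite yx -scalemxAl [X in 0 < X -> _]mxE pmulr_lgt0.
have := gnorm_model my; rewrite yx gnormZ ?ltW // (gnorm_model mx) mulr1 => ->.
by rewrite scale1r.
Qed.

(** * Isometries extend linearly *)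

Section LinearIsometry.
Context {R : realType} (g : geometry).

(** Linear maps that preserve distances in the model spaces. In Euclidean
    geometry, points have first coordinate [1] and their differences have first
    coordinate [0]; only at differences has the form to be preserved. *)
Definition form_preserving n n' (A : 'M[R]_(n.+1, n'.+1)) :=
  if g is Euclidean then
    (forall x : 'rV_n.+1, (x *m A) 0 0 = x 0 0) /\
    forall x y : 'rV_n.+1, x 0 0 = 0 -> y 0 0 = 0 ->
      mform g (x *m A) (y *m A) = mform g x y
  else forall x y : 'rV_n.+1, mform g (x *m A) (y *m A) = mform g x y.

Section Preservation.
Variables (n n' : nat) (A : 'M[R]_(n.+1, n'.+1)).
Hypothesis fA : form_preserving A.
Implicit Types x y v z : 'rV[R]_n.+1.

Lemma preserves_gauge x y : model g x -> model g y ->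
  gauge g (x *m A) (y *m A) = gauge g x y.
Proof.
rewrite /gauge; move: fA; rewrite /form_preserving /model.
case: g => [->//|[_ pA] x0 y0|->//].
by rewrite -mulmxBl pA // !mxE x0 y0 subrr.
Qed.

Lemma preserves_mdist x y : model g x -> model g y ->
  mdist g (x *m A) (y *m A) = mdist g x y.
Proof. by move=> mx my; rewrite !mdistE preserves_gauge. Qed.

Lemma preserves_direction v y : direction g (v *m A) (y *m A) = direction g v y *m A.
Proof.
rewrite /direction; move: fA; rewrite /form_preserving.
by case: g => [->|_|->]; rewrite ?mulmxBl ?mulmxDl ?scalemxAl.
Qed.

Lemma preserves_angle v y z : model g v -> model g y -> model g z ->
  angle g (v *m A) (y *m A) (z *m A) = angle g v y z.
Proof.
move=> mv my mz; rewrite /angle !preserves_direction.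
have E a b : model g a -> model g b ->
    mform g (direction g v a *m A) (direction g v b *m A) =
    mform g (direction g v a) (direction g v b).
  move: fA mv; rewrite /form_preserving /direction /model.
  case: g => [->//|[_ pA] v0 a0 b0|->//].
  by rewrite pA // !mxE ?a0 ?b0 v0 subrr.
by rewrite !E.
Qed.

End Preservation.

(** If [W *m Y = 1], then [W *m Y'] is the isometry that carries the generators
    [Y] to the vectors [Y'] with the same Gram matrix. A vector is determined by
    its products with the generators, which gives the last clause. *)
Lemma gram_extension N k (K K' : 'M[R]_N) (Y Y' : 'M[R]_(k, N)) :
  K \in unitmx -> row_full Y -> Y *m K *m Y^T = Y' *m K' *m Y'^T ->
  exists A : 'M[R]_N, [/\ A \in unitmx, A *m K' *m A^T = K
    & forall y y' : 'rV_N, y *m K *m Y^T = y' *m K' *m Y'^T -> y' = y *m A].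
Proof.
move=> uK /row_fullP[W WY] gram; pose A := W *m Y'.
have AK : A *m K' *m A^T = K.
  rewrite /A trmx_mul !mulmxA -(mulmxA W Y') -(mulmxA W _ Y'^T) -gram.
  by rewrite !mulmxA WY mul1mx -mulmxA -trmx_mul WY trmx1 mulmx1.
have uA : A \in unitmx.
  by apply: (@proj1 _ (K' *m A^T \in unitmx)); apply/andP; rewrite -unitmx_mul mulmxA AK.
have uKA : K' *m A^T \in unitmx by move: uK; rewrite -AK -mulmxA unitmx_mul => /andP[].
exists A; split=> // y y' /(congr1 (mulmx^~ W^T)).
rewrite -!mulmxA -!trmx_mul WY trmx1 mulmx1 -/A => e.
by apply: (can_inj (mulmxK uKA)); rewrite -e -mulmxA (mulmxA A) AK.
Qed.

(** A nondegenerate form that the distances determine on points of the model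
    space. The ambient form itself serves in curved geometry; in Euclidean
    geometry it is [dot (x - o) (y - o) + 1] at points [x] and [y], where [o] is
    a base point. *)
Definition based_form n (o : 'rV[R]_n.+1) : 'M[R]_n.+1 :=
  if g is Euclidean then
    let T := 1%:M - delta_mx 0 (0 : 'I_1) *m o in
    T *m T^T + delta_mx 0 (0 : 'I_1) *m delta_mx 0 0
  else form_matrix g n.

Definition based_form_of_gauge (a b c : R) : R :=
  if g is Euclidean then (b + c - a) / 2 + 1 else - a.

End LinearIsometry.

Section BasedForm.
Context {R : realType}.

Lemma based_form_euclidean n (o x y : 'rV[R]_n.+1) :
  (x *m based_form Euclidean o *m y^T) 0 0 =
  dot (x - x 0 0 *: o) (y - y 0 0 *: o) + x 0 0 * y 0 0.
Proof.
have colx (z : 'rV[R]_n.+1) : z *m delta_mx 0 (0 : 'I_1) = (z 0 0)%:M.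
  by apply/rowP => i; rewrite ord1 -colE !mxE eqxx.
have TE (z : 'rV[R]_n.+1) : z *m (1%:M - delta_mx 0 (0 : 'I_1) *m o) = z - z 0 0 *: o.
  by rewrite mulmxBr mulmx1 mulmxA colx mul_scalar_mx.
rewrite /based_form mulmxDr mulmxDl [LHS]mxE; congr (_ + _).
  by rewrite mulmxA TE -mulmxA -trmx_mul TE.
rewrite mulmxA colx -mulmxA mul_scalar_mx [LHS]mxE; congr (_ * _).
by rewrite -rowE !mxE.
Qed.

Lemma based_form_gauge g n (o x y : 'rV[R]_n.+1) :
  model g o -> model g x -> model g y ->
  (x *m based_form g o *m y^T) 0 0 =
  based_form_of_gauge g (gauge g x y) (gauge g x o) (gauge g y o).
Proof.
rewrite /gauge /based_form_of_gauge; case: g => mo mx my.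
- by rewrite /= opprK mformE.
- rewrite based_form_euclidean; have -> : x 0 0 = 1 by exact: mx.
  have -> : y 0 0 = 1 by exact: my.
  have -> : x - y = (x - o) - (y - o) by rewrite opprB addrA subrK.
  rewrite /= !scale1r /mform [dot (x - o - (y - o)) _]dot_sqrB; lra.
- by rewrite /= opprK mformE.
Qed.

Lemma based_form_unit g n (o : 'rV[R]_n.+1) : based_form g o \in unitmx.
Proof.
case: g; rewrite /based_form /form_matrix; first exact: unitmx1.
- rewrite -row_full_unit; apply: row_full_kernel => m Km.
  have := based_form_euclidean o m^T m^T.
  rewrite trmxK -mulmxA Km mulmx0 [LHS]mxE => /esym/eqP.
  rewrite paddr_eq0 ?dot_ge0 -?expr2 ?sqr_ge0 // sqrf_eq0 => /andP[/eqP d0 /eqP m0].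
  apply: trmx_inj; rewrite trmx0; apply: dot_eq0.
  by move: d0; rewrite m0 scale0r subr0.
- pose e := delta_mx 0 0 : 'M[R]_n.+1; have ee : e *m e = e by exact: mul_delta_mx.
  apply: (@proj1 _ _ (@mulmx1_unit _ _ _ (1%:M - 2 *: e) _)).
  rewrite mulmxBl mul1mx mulmxBr mulmx1 -scalemxAl -scalemxAr ee.
  by apply/matrixP => i j; rewrite !mxE; ring.
Qed.

End BasedForm.

(** The distances determine the Gram matrix of the spanning points [Y], hence a
    linear map that extends [phi]. *)
Lemma isometry_extension {R : realType} g n k (O : set 'rV[R]_n.+1)
    (phi : 'rV[R]_n.+1 -> 'rV[R]_n.+1) (Y : 'M[R]_(k, n.+1)) :
  (forall y, O y -> model g y) -> (forall y, O y -> model g (phi y)) ->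
  (forall y z, O y -> O z -> mdist g y z = mdist g (phi y) (phi z)) ->
  row_full Y -> (forall i, O (row i Y)) ->
  exists A : 'M[R]_n.+1, [/\ A \in unitmx, form_preserving g A
    & forall y, O y -> phi y = y *m A].
Proof.
move=> mO mphi iso fY OY; have [j0 _] := rows_inhabited fY.
pose o := row j0 Y; pose o' := phi o; have Oo : O o by exact: OY.
pose Y' := \matrix_i phi (row i Y).
have form y z : O y -> O z ->
    (y *m based_form g o *m z^T) 0 0 = (phi y *m based_form g o' *m (phi z)^T) 0 0.
  move=> Oy Oz; have ga a b : O a -> O b -> gauge g a b = gauge g (phi a) (phi b).
    by move=> Oa Ob; apply: mdist_gauge_inj; [exact: mO|exact: mO|exact: mphi|exact: mphi|exact: iso].
  rewrite (based_form_gauge (mO _ Oo) (mO _ Oy) (mO _ Oz)).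
  rewrite (based_form_gauge (mphi _ Oo) (mphi _ Oy) (mphi _ Oz)).
  by rewrite (ga y z) // (ga y o) // (ga z o).
have mulE p q (B : 'M[R]_(p, n.+1)) (C : 'M[R]_n.+1) (D : 'M[R]_(q, n.+1)) i j :
    (B *m C *m D^T) i j = (row i B *m C *m (row j D)^T) 0 0.
  by rewrite -row_mul [LHS]mxE [RHS]mxE; apply: eq_bigr => l _; rewrite !mxE.
have gram : Y *m based_form g o *m Y^T = Y' *m based_form g o' *m Y'^T.
  by apply/matrixP => i j; rewrite [LHS]mulE [RHS]mulE !rowK form.
have [A [uA AK ext]] := gram_extension (based_form_unit g o) fY gram.
have phiA y : O y -> phi y = y *m A.
  have row0E (x : 'rV[R]_n.+1) : row 0 x = x by apply/rowP => j; rewrite mxE.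
  move=> Oy; apply: ext; apply/rowP => j.
  by rewrite [LHS]mulE [RHS]mulE !row0E rowK form.
have AE (x y : 'rV[R]_n.+1) : (x *m A *m based_form g o' *m (y *m A)^T) 0 0 =
    (x *m based_form g o *m y^T) 0 0.
  by rewrite trmx_mul !mulmxA -(mulmxA x A) -(mulmxA x) AK.
exists A; split=> //; rewrite /form_preserving; move: AE; rewrite /based_form.
case: (g) mO mphi => mO' mphi' AE; try by move=> x y; rewrite !mformE AE.
have A0 (x : 'rV[R]_n.+1) : (x *m A) 0 0 = x 0 0.
  have A1 : A *m delta_mx 0 (0 : 'I_1) - delta_mx 0 0 = 0.
    have YA : Y *m (A *m delta_mx 0 (0 : 'I_1) - delta_mx 0 0) = 0.
      apply/row_matrixP => i; rewrite row_mul row0 mulmxBr mulmxA -phiA //.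
      rewrite -!colE; apply/rowP => l; rewrite !mxE.
      have -> : phi (row i Y) 0 0 = 1 by exact/mphi'.
      by have := mO' _ (OY i); rewrite /model /= mxE => ->; rewrite subrr.
    have /row_fullP[W WY] := fY.
    by rewrite -[LHS]mul1mx -WY -mulmxA YA mulmx0.
  apply/eqP; rewrite -subr_eq0; apply/eqP.
  have /(congr1 (fun B => (x *m B) 0 0)) := A1.
  by rewrite mulmxBr mulmxA mulmx0 -!colE !mxE.
split=> // x y x0 y0; have := AE x y.
rewrite !based_form_euclidean !A0 x0 y0 !scale0r !subr0 mul0r !addr0.
by rewrite /mform.
Qed.

Lemma polyhedron_linear_image {R : realType} g n n' (P : set 'rV[R]_n.+1)
    (P' : set 'rV[R]_n'.+1) (A : 'M[R]_(n.+1, n'.+1)) :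
  convex_polyhedron g P -> convex_polyhedron g P' ->
  (forall y, open_polyhedron g P y -> P' (y *m A)) ->
  forall y, P y -> P' (y *m A).
Proof.
move=> polP polP' PA y Py; apply: (polyhedron_closed polP') => U Uy.
have := @mulmx_continuous R 1 _ _ A y U Uy => Uy'.
have [z oz Uz] := open_polyhedron_dense polP Py Uy'.
by exists (z *m A); split=> //; exact: PA.
Qed.

(** [A] induces an isometry of [P] onto [P'], and [A'] carries the points back. *)
Record polyhedron_isometry {R : realType} g n n' (P : set 'rV[R]_n.+1)
    (P' : set 'rV[R]_n'.+1) (A : 'M[R]_(n.+1, n'.+1))
    (A' : 'M[R]_(n'.+1, n.+1)) : Prop := PolyhedronIsometry {
  isometryVK : A' *m A = 1%:M;
  isometry_form : form_preserving g A;
  isometry_sub : forall y, P y -> P' (y *m A);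
  isometry_inv_sub : forall y, P' y -> P (y *m A');
  isometry_open : forall y, open_polyhedron g P y -> open_polyhedron g P' (y *m A) }.

(** An isometry between the interiors is linear, and so extends to the closures,
    in which the interiors are dense. *)
Lemma isometric_polyhedra {R : realType} g n n' (T : Type)
    (P : set 'rV[R]_n.+1) (P' : set 'rV[R]_n'.+1)
    (f : 'rV[R]_n.+1 -> T) (f' : 'rV[R]_n'.+1 -> T) :
  n = n' -> convex_polyhedron g P -> convex_polyhedron g P' ->
  set_inj (open_polyhedron g P') f' ->
  isometric_parametrisations g (open_polyhedron g P) f (open_polyhedron g P') f' ->
  exists A A', polyhedron_isometry g P P' A A' /\
    forall y, open_polyhedron g P y -> f y = f' (y *m A).
Proof.
move=> e; subst n' => polP polP' inj' [img iso].
have [k [Y [fY oY]]] := open_polyhedron_spanning polP.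
have /choice[phi phiP] : forall y, exists y', open_polyhedron g P y ->
    open_polyhedron g P' y' /\ f y = f' y'.
  move=> y; have [oy|noy] := pselect (open_polyhedron g P y); last by exists 0.
  have : (f' @` open_polyhedron g P') (f y) by rewrite -img; exists y.
  by case=> y' oy' fy'; exists y'.
have mO y : open_polyhedron g P y -> model g y.
  by move=> /open_polyhedron_sub/(polyhedron_model polP).
have mphi y : open_polyhedron g P y -> model g (phi y).
  by move=> /phiP[/open_polyhedron_sub/(polyhedron_model polP')].
have isophi y z : open_polyhedron g P y -> open_polyhedron g P z ->
    mdist g y z = mdist g (phi y) (phi z).
  by move=> oy oz; have [oy' fy] := phiP y oy; have [oz' fz] := phiP z oz; exact: iso.
have [A [uA fA phiA]] := isometry_extension mO mphi isophi fY oY.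
have oA y : open_polyhedron g P y -> open_polyhedron g P' (y *m A).
  by move=> oy; rewrite -phiA //; have [] := phiP y oy.
have oA' y : open_polyhedron g P' y -> open_polyhedron g P (y *m invmx A).
  move=> oy; have : (f @` open_polyhedron g P) (f' y) by rewrite img; exists y.
  case=> z oz fz; have [oz' fz'] := phiP z oz.
  have -> : y = z *m A by rewrite -phiA //; apply: inj'; rewrite ?inE // -fz' fz.
  by rewrite mulmxK.
exists A, (invmx A); split; last first.
  by move=> y oy; rewrite -phiA //; have [] := phiP y oy.
have PA := polyhedron_linear_image polP polP' (fun y oy => open_polyhedron_sub (oA y oy)).
have PA' := polyhedron_linear_image polP' polP (fun y oy => open_polyhedron_sub (oA' y oy)).
exact: PolyhedronIsometry (mulVmx uA) fA PA PA' oA.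
Qed.

(** * Cells of a polyhedral complex *)

Lemma within_continuous_near (T U : topologicalType) (A : set T) (f : T -> U) y
    (W : set U) :
  {within A, continuous f} -> A y -> nbhs (f y) W ->
  \forall y' \near y, A y' -> W (f y').
Proof. by move=> /subspace_continuousP fc Ay Wy; have := fc y Ay W Wy. Qed.

Lemma closed_finite_bigcup (T : topologicalType) (I : Type) (D : set I)
    (F : I -> set T) :
  finite_set D -> (forall i, D i -> closed (F i)) -> closed (\bigcup_(i in D) F i).
Proof.
move=> finD clF; have -> : \bigcup_(i in D) F i = \bigcup_(A in F @` D) A.
  by rewrite bigcup_image.
apply: closed_bigcup; first exact: finite_image.
by move=> _ [i Di <-]; exact: clF.
Qed.

Section Cells.
Context {R : realType} {g : geometry} {d : nat} (X : polyhedralComplex R g d).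
Implicit Types c e : cell X.

Lemma cell_polyhedron c : convex_polyhedron g (cell_shape c).
Proof. by have [] := complex_polyhedral X. Qed.

Lemma space_hausdorff : hausdorff_space X.
Proof. by have [[]] := complex_CW X. Qed.

Lemma char_map_continuous c : {within cell_shape c, continuous (char_map c)}.
Proof. by have [[_ /(_ c)]] := complex_CW X. Qed.

Lemma char_map_inj c : set_inj (open_shape g c) (char_map c).
Proof. by have [[_ _ /(_ c)]] := complex_CW X. Qed.

Lemma open_cell_exists (x : X) : exists c, open_cell g c x.
Proof. by have [[_ _ _ /(_ x)[c [cx _]]]] := complex_CW X; exists c. Qed.

Lemma open_cell_unique c c' (x : X) : open_cell g c x -> open_cell g c' x -> c = c'.
Proof.
have [[_ _ _ /(_ x)[c0 [_ uniq]]] _ _] := complex_CW X.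
by move=> /uniq <- /uniq.
Qed.

Lemma cell_boundary c y : cell_shape c y -> ~ open_shape g c y ->
  exists2 e, (cdim e < cdim c)%N & open_cell g e (char_map c y).
Proof.
move=> cy oy; have [_ /(_ c)[D _ [Dlt Dc]] _] := complex_CW X.
have [e De eo] : (\bigcup_(c' in D) open_cell g c') (char_map c y).
  by apply: Dc; exists y.
by exists e => //; exact: Dlt.
Qed.

Lemma open_cell_sub c : open_cell g c `<=` closed_cell c.
Proof. by move=> _ [y /open_polyhedron_sub cy <-]; exists y. Qed.

Lemma closed_cell_closed c : closed (closed_cell c).
Proof.
apply: compact_closed; first exact: space_hausdorff.
apply: continuous_compact; first exact: char_map_continuous.
exact: polyhedron_compact (cell_polyhedron c).
Qed.

(** By density of the open shape. *)
Lemma closed_cell_min c (A : set X) : closed A -> open_cell g c `<=` A ->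
  closed_cell c `<=` A.
Proof.
move=> clA cA _ [y cy <-]; apply: clA => U Uy.
have near_y := within_continuous_near (@char_map_continuous c) cy Uy.
have [z oz Uz] := open_polyhedron_dense (cell_polyhedron c) cy near_y.
exists (char_map c z); split; last exact: Uz (open_polyhedron_sub oz).
by apply: cA; exists z.
Qed.

(** Boundary points lie in closed cells that come from facets, because open
    facets are dense in the boundary and only finitely many cells meet it. *)
Lemma closed_cell_boundary c y : cell_shape c y -> ~ open_shape g c y ->
  exists2 e, (cdim e < cdim c)%N &
    closed_cell e `<=` closed_cell c /\ closed_cell e (char_map c y).
Proof.
move=> cy oy; have [_ /(_ c)[D finD [Dlt Dc]] _] := complex_CW X.
pose E := D `&` [set e | closed_cell e `<=` closed_cell c].
suff [e [De ec] ey] : (\bigcup_(e in E) closed_cell e) (char_map c y).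
  by exists e => //; exact: Dlt.
have clE : closed (\bigcup_(e in E) closed_cell e).
  apply: closed_finite_bigcup => [|e _]; last exact: closed_cell_closed.
  exact: finite_setIl.
apply: contrapT => yE.
have near_y : \forall y' \near y, cell_shape c y' ->
    ~ (\bigcup_(e in E) closed_cell e) (char_map c y').
  apply: (@within_continuous_near _ _ _ _ _ (~` \bigcup_(e in E) closed_cell e)
    (@char_map_continuous c) cy).
  by apply: open_nbhs_nbhs; split=> //; exact: closed_openC.
have [z [l [zE lfacet lz]]] := polyhedron_facet (cell_polyhedron c) cy oy near_y.
have cz : cell_shape c z by case: lz.
have [_ /(_ c l lfacet)[c' [dimc [img _]]]] := complex_polyhedral X.
have c'z : open_cell g c' (char_map c z) by rewrite /open_cell -img; exists z.
have oz : ~ open_shape g c z.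
  move=> oz; have ec : c = c' by apply: open_cell_unique c'z; exists z.
  by move: dimc; rewrite -ec => /esym/eqP; rewrite eqn_leq ltnn.
apply: (zE cz); exists c'; last exact: open_cell_sub.
split; last first.
  apply: closed_cell_min (@closed_cell_closed c) _.
  by rewrite /open_cell -img => _ [z' [cz' _ _] <-]; exists z'.
have [e De ez] : (\bigcup_(c' in D) open_cell g c') (char_map c z).
  by apply: Dc; exists z.
by rewrite (open_cell_unique c'z ez).
Qed.

(** Descending through facets ends at a cell that has [x] in its interior. *)
Lemma closed_cell_face c e (x : X) : open_cell g e x -> closed_cell c x ->
  closed_cell e `<=` closed_cell c.
Proof.
have [m] := ubnP (cdim c); elim: m c => // m ih c; rewrite ltnS => le_m ex [y cy xE].
subst x; have [oy|oy] := pselect (open_shape g c y).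
  have cx : open_cell g c (char_map c y) by exists y.
  by rewrite (open_cell_unique ex cx).
have [e' lt_e [sub_e e'y]] := closed_cell_boundary cy oy.
apply: subset_trans sub_e; exact: ih (leq_trans lt_e le_m) ex e'y.
Qed.

Lemma closed_cell_vertex c : exists2 x, vertices X x & closed_cell c x.
Proof.
have [m] := ubnP (cdim c); elim: m c => // m ih c; rewrite ltnS => le_m.
have [c0|c_gt0] := posnP (cdim c).
  have [y oy] := open_polyhedron_neq0 (cell_polyhedron c).
  exists (char_map c y); last by apply: open_cell_sub; exists y.
  by exists c => //; exists y.
have [y cy oy] := polyhedron_boundary_neq0 (cell_polyhedron c) c_gt0.
have [e lt_e [sub_e _]] := closed_cell_boundary cy oy.
by have [x vx ex] := ih e (leq_trans lt_e le_m); exists x => //; exact: sub_e.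
Qed.

Lemma common_vertex c c' (x : X) : closed_cell c x -> closed_cell c' x ->
  exists v, [/\ vertices X v, closed_cell c v & closed_cell c' v].
Proof.
move=> cx c'x; have [e ex] := open_cell_exists x.
have [v vv ev] := closed_cell_vertex e; exists v; split=> //.
  exact: closed_cell_face ex cx _ ev.
exact: closed_cell_face ex c'x _ ev.
Qed.

Lemma closed_cell_dim0 c (x x' : X) : cdim c = 0%N -> closed_cell c x ->
  closed_cell c x' -> x = x'.
Proof.
move=> c0 [y cy <-] [y' cy' <-]; congr char_map.
have := cell_polyhedron c; move: cy cy'; move: (cell_shape c) y y'; rewrite c0.
by move=> P y y' Py Py' polP; exact: polyhedron_dim0 polP Py Py'.
Qed.

Section LocallyFinite.
Hypothesis X_locally_finite : locally_finite X.

Lemma closed_cells_closed (Q : set (cell X)) :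
  closed (\bigcup_(c in Q) closed_cell c).
Proof.
move=> x clx; have [U Ux finU] := X_locally_finite x.
pose Q' := Q `&` [set c | closed_cell c `&` U !=set0].
have clQ' : closed (\bigcup_(c in Q') closed_cell c).
  apply: closed_finite_bigcup => [|e _]; last exact: closed_cell_closed.
  exact: finite_setIr.
suff [c [Qc _] cx] : (\bigcup_(c in Q') closed_cell c) x by exists c.
apply: clQ' => W Wx; have [z [[c Qc cz] [Uz Wz]]] := clx _ (filterI Ux Wx).
by exists z; split=> //; exists c => //; split=> //; exists z.
Qed.

(** The cells with the property and the other ones have closed and disjoint
    unions, which cover the complex. *)
Lemma adjacency_connected (Q : set (cell X)) : connected [set: X] ->
  (forall c c', cdim c = d -> cdim c' = d -> Q c ->
     closed_cell c `&` closed_cell c' !=set0 -> Q c') ->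
  forall c0, cdim c0 = d -> Q c0 -> forall c, cdim c = d -> Q c.
Proof.
move=> conX adj c0 dim0 Q0 c dimc; have [_ _ pureX] := complex_pure X.
pose B := \bigcup_(e in Q `&` [set e | cdim e = d]) closed_cell e.
pose B' := \bigcup_(e in ~` Q `&` [set e | cdim e = d]) closed_cell e.
have BB' : B = ~` B'.
  apply/seteqP; split=> x.
    move=> [e [Qe de] ex] [e' [nQ de'] e'x]; apply: nQ.
    by apply: (adj e) => //; exists x.
  move=> xB'; have [e ex] := open_cell_exists x.
  have [c' dc' sub] := pureX e; have c'x := sub _ (open_cell_sub ex).
  exists c' => //; split=> //; apply: contrapT => nQ.
  by apply: xB'; exists c'.
have BT : B = [set: X].
  apply: conX.
  - have [y oy] := open_polyhedron_neq0 (cell_polyhedron c0).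
    by exists (char_map c0 y), c0 => //; apply: open_cell_sub; exists y.
  - exists B; last by rewrite setTI.
    by rewrite BB'; apply: closed_openC; exact: closed_cells_closed.
  - by exists B; [exact: closed_cells_closed | rewrite setTI].
have [y oy] := open_polyhedron_neq0 (cell_polyhedron c).
have cx : closed_cell c (char_map c y) by apply: open_cell_sub; exists y.
have [e [Qe de] ex] : B (char_map c y) by rewrite BT.
by apply: (adj e) => //; exists (char_map c y).
Qed.

End LocallyFinite.

End Cells.

(** * Points of spherical simplices *)

(** The difference of the gauges is linear on the model space: the set of points
    at equal distance from two points is a hyperplane section. *)
Lemma bisector {R : realType} g n (v v' : 'rV[R]_n.+1) :
  model g v -> model g v' -> v != v' ->
  exists2 l : 'cV[R]_n.+1, 0 < (v *m l) 0 0 &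
    forall y, model g y -> 0 < (y *m l) 0 0 -> mdist g v y <> mdist g v' y.
Proof.
move=> mv mv' neq.
suff [l lE] : exists l : 'cV[R]_n.+1, forall y, model g y ->
    (y *m l) 0 0 = gauge g v' y - gauge g v y.
  exists l => [|y my]; rewrite lE // subr_gt0.
    have [_] := gauge_ge mv mv; rewrite eqxx => /eqP <-.
    have [le eq] := gauge_ge mv' mv.
    by rewrite lt_neqAle eq le andbT eq_sym.
  by move=> lt /(mdist_gauge_inj mv my mv' my) e; move: lt; rewrite e ltxx.
rewrite /gauge; case: g mv mv' => mv mv'.
- exists (form_matrix Spherical n *m (v - v')^T) => y _.
  by rewrite mulmxA -mformE !mform_bilin !(mformC _ y); ring.
- exists (2 *: (v - v')^T + (dot v' v' - dot v v) *: delta_mx 0 0) => y my.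
  have yv : (y *m (v - v')^T) 0 0 = dot y v - dot y v'.
    by rewrite -dotNr -dotDr.
  rewrite mulmxDr -!scalemxAr -colE [LHS]mxE [X in X + _]mxE [X in _ + X]mxE yv.
  have -> : col 0 y 0 0 = 1 by rewrite mxE; exact: my.
  by rewrite /mform !dot_sqrB (dotC v' y) (dotC v y); ring.
- exists (form_matrix Hyperbolic n *m (v - v')^T) => y _.
  by rewrite mulmxA -mformE !mform_bilin !(mformC _ y); ring.
Qed.

Section SimplexPoints.
Context {R : realType} (L : sphericalComplex R).
Implicit Types (w : {ffun lvertex L -> R}) (s : {set lvertex L}) (t : lvertex L).

Definition vertex_point t : {ffun lvertex L -> R} := [ffun a => (a == t)%:R].

Lemma vertex_point_inj : injective vertex_point.
Proof.
move=> t t' /ffunP/(_ t); rewrite !ffunE eqxx => /eqP.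
by rewrite eqr_nat; case: (eqVneq t t').
Qed.

Lemma wsupport_vertex_point t : wsupport (vertex_point t) = [set t]%SET.
Proof.
by apply/setP => a; rewrite !inE ffunE pnatr_eq0; case: (eqVneq a t).
Qed.

Lemma lform_vertex w t : lform w (vertex_point t) = \sum_a w a * cosine a t.
Proof.
apply: eq_bigr => a _; rewrite (bigD1 t) //= big1 ?addr0 => [|b /negPf bt].
  by rewrite ffunE eqxx mulr1.
by rewrite ffunE bt mulr0 mul0r.
Qed.

Lemma lformC w w' : lform w w' = lform w' w.
Proof.
rewrite /lform exchange_big; apply: eq_bigr => a _; apply: eq_bigr => b _.
by rewrite cosine_sym; ring.
Qed.

Lemma lform_vertex_point t : lform (vertex_point t) (vertex_point t) = 1.
Proof.
rewrite lform_vertex (bigD1 t) //= big1 ?addr0 => [|b /negPf bt].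
  by rewrite ffunE eqxx mul1r cosine_diag.
by rewrite ffunE bt mul0r.
Qed.

Lemma realisation_vertex_point t : realisation (vertex_point t).
Proof.
split; [|by rewrite wsupport_vertex_point; exact: simplices_vertex|exact: lform_vertex_point].
by move=> a; rewrite ffunE ler0n.
Qed.

Lemma closed_simplex_vertex_point s t : closed_simplex s (vertex_point t) <-> t \in s.
Proof.
rewrite -finset.sub1set -wsupport_vertex_point; split=> [[]//|ts].
by split=> //; exact: realisation_vertex_point.
Qed.

Lemma lformDZ a w w' w'' :
  lform [ffun b => w b + a * w' b] w'' = lform w w'' + a * lform w' w''.
Proof.
rewrite /lform mulr_sumr -big_split; apply: eq_bigr => b _ /=.
rewrite mulr_sumr -big_split; apply: eq_bigr => b' _ /=.
by rewrite ffunE; ring.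
Qed.

Lemma lform_on s w : wsupport w \subset s ->
  lform w w = \sum_(a in s) \sum_(b in s) w a * w b * cosine a b.
Proof.
move=> /fintype.subsetP ws; have w0 a : a \notin s -> w a = 0.
  by move=> as0; apply/eqP; apply: contraNT as0 => wa; apply: ws; rewrite inE.
rewrite /lform [RHS]big_mkcond; apply: eq_bigr => a _; case: ifP => [as1|/negbT /w0 a0].
  rewrite [RHS]big_mkcond; apply: eq_bigr => b _.
  by case: ifP => // /negbT /w0 ->; rewrite mulr0 mul0r.
by rewrite big1 // => b _; rewrite a0 !mul0r.
Qed.

Lemma closed_simplex_set1 t w : closed_simplex [set t]%SET w -> w = vertex_point t.
Proof.
move=> [[w0 _ ww] ws].
have wt : w t = 1.
  move: ww; rewrite (lform_on ws) !big_set1 cosine_diag mulr1 -expr2 => /eqP.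
  by rewrite sqrp_eq1 // => /eqP.
apply/ffunP => a; rewrite ffunE; have [->//|at'] := eqVneq a t.
apply/eqP; apply: contraNT at' => wa; rewrite -finset.in_set1.
by apply: (fintype.subsetP ws); rewrite inE.
Qed.

Lemma lform_posdef s w : s \in simplices L -> wsupport w \subset s ->
  lform w w <= 0 -> w = [ffun=> 0].
Proof.
move=> sL ws le0; apply/ffunP => t; rewrite ffunE; apply/eqP; apply: contraLR le0 => wt.
rewrite -ltNge (lform_on ws); apply: cosine_posdef => //; exists t => //.
by apply: (fintype.subsetP ws); rewrite inE.
Qed.

Lemma lform_ge0 s w : s \in simplices L -> wsupport w \subset s -> 0 <= lform w w.
Proof.
move=> sL ws; rewrite leNgt; apply/negP => lt0.
have w0 := lform_posdef sL ws (ltW lt0); move: lt0; rewrite w0 /lform.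
by rewrite big1 ?ltxx // => a _; rewrite big1 // => b _; rewrite ffunE !mul0r.
Qed.

(** The Cauchy-Schwarz inequality, so that [acos (lform w (vertex_point t))] is
    a distance. *)
Lemma lform_vertex_range s w t : s \in simplices L -> closed_simplex s w ->
  t \in s -> -1 <= lform w (vertex_point t) <= 1.
Proof.
move=> sL [[_ _ ww] ws] ts; set a := lform _ _.
pose w1 : {ffun lvertex L -> R} := [ffun b => w b + (- a) * vertex_point t b].
have w1s : wsupport w1 \subset s.
  apply/fintype.subsetP => b; rewrite inE ffunE ffunE; have [->//|bt] := eqVneq b t.
  by rewrite mulr0 addr0 => wb; apply: (fintype.subsetP ws); rewrite inE.
have := lform_ge0 sL w1s.
rewrite {1}/w1 lformDZ (lformC _ w1) (lformC (vertex_point t) w1) /w1 !lformDZ.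
rewrite ww (lformC _ w) -/a lform_vertex_point => ge0.
rewrite -ler_norml -(@ler_pXn2r _ 2) ?nnegrE // expr1n real_normK ?num_real //.
by rewrite expr2; lra.
Qed.

(** The form is positive definite on the span of the simplex, and the difference
    of [w] and [w'] is orthogonal to the vertices. *)
Lemma lform_vertex_separates s w w' : s \in simplices L ->
  closed_simplex s w -> closed_simplex s w' ->
  (forall t, t \in s -> lform w (vertex_point t) = lform w' (vertex_point t)) ->
  w = w'.
Proof.
move=> sL [_ ws] [_ ws'] eqs.
pose w1 : {ffun lvertex L -> R} := [ffun b => w b + (- 1) * w' b].
have w1s : wsupport w1 \subset s.
  apply/fintype.subsetP => b; rewrite inE ffunE; apply: contraR => bs.
  have z (w0 : {ffun lvertex L -> R}) : wsupport w0 \subset s -> w0 b = 0.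
    move=> /fintype.subsetP w0s; apply/eqP; apply: contraNT bs => w0b.
    by apply: w0s; rewrite inE.
  by rewrite !z // mulr0 addr0.
have w10 : w1 = [ffun=> 0].
  apply: (lform_posdef sL w1s).
  suff -> : lform w1 w1 = 0 by [].
  rewrite /lform exchange_big big1 // => b _.
  have -> : \sum_a w1 a * w1 b * cosine a b = w1 b * lform w1 (vertex_point b).
    by rewrite lform_vertex mulr_sumr; apply: eq_bigr => a _; ring.
  have [bs|bs] := boolP (b \in s).
    by rewrite lformDZ eqs // mulN1r subrr mulr0.
  have /eqP -> : w1 b == 0; last by rewrite mul0r.
  by apply: contraNT bs => w1b; apply: (fintype.subsetP w1s); rewrite inE.
apply/ffunP => b; apply/eqP; rewrite -subr_eq0.
by have /ffunP/(_ b) := w10; rewrite !ffunE mulN1r => ->.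
Qed.

End SimplexPoints.

(** * Automorphisms and links *)

Section AutomorphismCells.
Context {R : realType} {g : geometry} {d : nat} (X : polyhedralComplex R g d).
Implicit Types (f : PolyAut X) (c : cell X) (x : X).

(** On the open shape [f] is an isometry, hence linear; by continuity and density
    the same formula holds on the boundary. *)
Lemma aut_cell f c : exists c' A A',
  [/\ cdim c = cdim c', polyhedron_isometry g (cell_shape c) (cell_shape c') A A'
    & forall y, cell_shape c y -> f (char_map c y) = char_map c' (y *m A)].
Proof.
have [c' [dimc iso]] := aut_fun_cells f c.
have [A [A' [isoA openA]]] := isometric_polyhedra dimc (cell_polyhedron c)
  (cell_polyhedron c') (@char_map_inj _ _ _ _ c') iso.
exists c', A, A'; split=> // y cy; apply: (@space_hausdorff _ _ _ X) => U W Uy Wy.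
have near_U := within_continuous_near (@char_map_continuous _ _ _ _ c) cy
  (@aut_fun_continuous _ _ _ _ f _ _ Uy).
have near_W := within_continuous_near (@char_map_continuous _ _ _ _ c')
  (isometry_sub isoA cy) Wy.
have near_W' := @mulmx_continuous _ _ _ _ A y _ near_W.
have [z oz [Uz Wz]] := open_polyhedron_dense (cell_polyhedron c) cy
  (filterI near_U near_W').
have cz := open_polyhedron_sub oz.
exists (f (char_map c z)); split; first exact: Uz.
by rewrite [f _]openA //; apply/Wz/(isometry_sub isoA).
Qed.

Lemma corner_image f c c' A A' x v : f x = x ->
  cdim c = cdim c' -> polyhedron_isometry g (cell_shape c) (cell_shape c') A A' ->
  (forall y, cell_shape c y -> f (char_map c y) = char_map c' (y *m A)) ->
  @corner _ _ _ _ x c v -> @corner _ _ _ _ x c' (v *m A).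
Proof.
move=> fx dimc isoA fA [c0 cv vx]; split; first by rewrite -dimc.
  exact: isometry_sub isoA _ cv.
by rewrite -fA // vx.
Qed.

Lemma corner_sphere_image f c c' A A' v r :
  polyhedron_isometry g (cell_shape c) (cell_shape c') A A' ->
  (forall y, cell_shape c y -> f (char_map c y) = char_map c' (y *m A)) ->
  cell_shape c v ->
  char_map c' @` corner_sphere (v *m A) r = f @` (char_map c @` corner_sphere v r).
Proof.
move=> isoA fA cv; have mc y : cell_shape c y -> model g y.
  by move=> cy; exact: (polyhedron_model (cell_polyhedron c) cy).
apply/seteqP; split=> [_ [y' [cy' dy'] <-]|_ [_ [y [cy dy] <-] <-]].
  have y'E : y' = y' *m A' *m A by rewrite -mulmxA (isometryVK isoA) mulmx1.
  have cy := isometry_inv_sub isoA cy'.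
  exists (char_map c (y' *m A')); last by rewrite fA // -y'E.
  exists (y' *m A') => //; split=> //.
  by rewrite -dy' [in RHS]y'E (preserves_mdist (isometry_form isoA)) //; exact: mc.
rewrite fA //; exists (y *m A) => //; split; first exact: isometry_sub isoA _ cy.
by rewrite (preserves_mdist (isometry_form isoA)) //; exact: mc.
Qed.

End AutomorphismCells.

Section LinkAction.
Context {R : realType} {g : geometry} {d : nat} {X : polyhedralComplex R g d}.
Variables (x : X) (L : sphericalComplex R).
Implicit Types (f : PolyAut X) (c : cell X) (h : {ffun lvertex L -> R} -> X).

(** The conditions that make [h] an isometry of [L] onto the sphere of radius [r]
    about [x] in the definition of [link_isometric]. *)
Definition link_chart (r : R) h :=
  [/\ set_bij (@realisation R L) (link_sphere x r) h,
      forall c (v : 'rV[R]_(cdim c).+1), corner x v ->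
        exists s, link_cell_isometry v r h s
    & forall s, s \in simplices L ->
        exists c (v : 'rV[R]_(cdim c).+1),
          corner x v /\ link_cell_isometry v r h s].

Definition link_action h (f : X -> X) (s : {perm lvertex L}) :=
  forall t, f (h (vertex_point t)) = h (vertex_point (s t)).

Section Chart.
Variables (r : R) (h : {ffun lvertex L -> R} -> X).
Hypothesis chart : link_chart r h.

Lemma chart_inj w w' : realisation w -> realisation w' -> h w = h w' -> w = w'.
Proof. by have [[_ inj _] _ _] := chart; move=> rw rw'; apply: inj; rewrite inE. Qed.

Lemma chart_vertex_inj : injective (fun t : lvertex L => h (vertex_point t)).
Proof.
move=> t t' /(chart_inj (realisation_vertex_point t) (realisation_vertex_point t')).
exact: vertex_point_inj.
Qed.

Lemma chart_vertex_mem s t :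
  (h @` closed_simplex s) (h (vertex_point t)) <-> t \in s.
Proof.
split=> [[w ws hw]|ts]; last by exists (vertex_point t) => //; apply/closed_simplex_vertex_point.
have wt : w = vertex_point t.
  by apply: chart_inj hw; [case: ws | exact: realisation_vertex_point].
by apply/closed_simplex_vertex_point; rewrite -wt.
Qed.

(** A vertex of the link is the sphere about a corner of a 1-cell, and [f] carries
    corners of 1-cells to corners of 1-cells. *)
Lemma chart_vertex_image f t : f x = x ->
  exists t', f (h (vertex_point t)) = h (vertex_point t').
Proof.
move=> fx; have [_ corners simpl] := chart.
have [c [v [cv [_ card_t himg _]]]] := simpl _ (simplices_vertex t).
have [c' [A [A' [dimc isoA fA]]]] := aut_cell f c.
have c'v := corner_image fx dimc isoA fA cv.
have [s [_ card_s himg' _]] := corners _ _ c'v.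
have /cards1P[t' st'] : #|s| == 1%N by rewrite card_s -dimc -card_t cards1.
have cvs : cell_shape c v by case: cv.
have : (h @` closed_simplex s) (f (h (vertex_point t))).
  rewrite himg' (corner_sphere_image _ isoA fA cvs) -himg.
  exists (h (vertex_point t)) => //.
  by exists (vertex_point t) => //; apply/closed_simplex_vertex_point; rewrite inE.
case=> w ws hw; exists t'; rewrite -hw; congr h; apply: closed_simplex_set1.
by rewrite -st'.
Qed.

Lemma link_action_exists f : f x = x -> exists s, link_action h f s.
Proof.
move=> fx; have /choice[p pP] := fun t => chart_vertex_image t fx.
have pinj : injective p.
  move=> t t' e; apply: chart_vertex_inj; apply: (can_inj (aut_funK f)).
  by rewrite !pP e.
by exists (perm pinj) => t; rewrite permE.
Qed.

Lemma link_action_uniq (f : X -> X) s s' :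
  link_action h f s -> link_action h f s' -> s = s'.
Proof.
by move=> fs fs'; apply/permP => t; apply: chart_vertex_inj; rewrite -fs fs'.
Qed.

Lemma link_action_comp (f f' : X -> X) s s' :
  link_action h f s -> link_action h f' s' -> link_action h (f \o f') (s' * s)%g.
Proof. by move=> fs fs' t; rewrite /= fs' fs permM. Qed.

Lemma link_actionV f s : link_action h f s -> link_action h (aut_inverse f) s^-1%g.
Proof.
move=> fs t; apply: (can_inj (aut_funK f)); rewrite [LHS]aut_invK fs.
by rewrite permKV.
Qed.

Lemma link_action_simplex f s c c' A A' (v : 'rV[R]_(cdim c).+1) S S' :
  link_action h f s -> cdim c = cdim c' ->
  polyhedron_isometry g (cell_shape c) (cell_shape c') A A' ->
  (forall y, cell_shape c y -> f (char_map c y) = char_map c' (y *m A)) ->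
  cell_shape c v -> link_cell_isometry v r h S ->
  link_cell_isometry (v *m A) r h S' -> (s @: S)%SET = S'.
Proof.
move=> fs dimc isoA fA cv [_ cardS hS _] [_ cardS' hS' _].
apply/eqP; rewrite eqEcard card_imset ?cardS ?cardS' ?dimc ?leqnn ?andbT; last exact: perm_inj.
apply/fintype.subsetP => _ /imsetP[t tS ->]; apply/chart_vertex_mem.
rewrite hS' (corner_sphere_image _ isoA fA cv) -hS -fs.
by exists (h (vertex_point t)) => //; apply/chart_vertex_mem.
Qed.

Lemma link_action_sub f s S : f x = x -> link_action h f s ->
  S \in simplices L -> (s @: S)%SET \in simplices L.
Proof.
move=> fx fs SL; have [_ corners simpl] := chart.
have [c [v [cv vS]]] := simpl _ SL.
have [c' [A [A' [dimc isoA fA]]]] := aut_cell f c.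
have c'v := corner_image fx dimc isoA fA cv.
have [S' vS'] := corners _ _ c'v; have cvs : cell_shape c v by case: cv.
by rewrite (link_action_simplex fs dimc isoA fA cvs vS vS'); case: vS'.
Qed.

Lemma link_action_saut f s : f x = x -> link_action h f s -> s \in saut L.
Proof.
move=> fx fs; rewrite inE; apply/forallP => S; apply/eqP; apply/idP/idP.
  have f'x : aut_inverse f x = x by apply: (can_inj (aut_funK f)); rewrite /= aut_invK fx.
  move=> /(link_action_sub f'x (link_actionV fs)); rewrite -imset_comp.
  have sK : (s^-1)%g \o s =1 id by move=> t; exact: permK.
  by rewrite (eq_imset _ sK) imset_id.
exact: (link_action_sub fx fs).
Qed.

Lemma link_action_fix f s c : link_action h f s -> f x = x ->
  closed_cell c x -> (0 < cdim c)%N ->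
  (forall z, closed_cell c z -> f z = z) ->
  exists S, [/\ S \in simplices L, #|S| = cdim c & s \in sfix S].
Proof.
move=> fs fx [v cv vx] c0 fixc; have [_ corners _] := chart.
have cx : corner x v by [].
have [S [SL cardS hS _]] := corners _ _ cx; exists S; split=> //.
rewrite inE (link_action_saut fx fs); apply/astabP => t tS.
apply: chart_vertex_inj; rewrite /= [X in vertex_point X](_ : _ = s t) // -fs fixc //.
have : (h @` closed_simplex S) (h (vertex_point t)) by apply/chart_vertex_mem.
by rewrite hS => -[y [cy _] <-]; exists y.
Qed.

End Chart.

End LinkAction.

(** * Faithfulness of the action on the link *)

Section Faithfulness.
Context {R : realType} {g : geometry} {d : nat} {X : polyhedralComplex R g d}.
Variables (x : X) (L : sphericalComplex R).
Implicit Types (f : PolyAut X) (c : cell X).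

(** In a spherical simplex a point is determined by its distances to the vertices;
    here these distances are the angles at [v], which [A] preserves. *)
Lemma link_simplex_fixed f c (A : 'M[R]_((cdim c).+1)) A'
    (v : 'rV[R]_(cdim c).+1) r (h : {ffun lvertex L -> R} -> X) S :
  polyhedron_isometry g (cell_shape c) (cell_shape c) A A' ->
  (forall y, cell_shape c y -> f (char_map c y) = char_map c (y *m A)) ->
  cell_shape c v -> v *m A = v -> link_action h f 1%g ->
  link_cell_isometry v r h S ->
  forall y, corner_sphere v r y -> f (char_map c y) = char_map c y.
Proof.
move=> isoA fA cv vA act [SL _ hS iso] y Sy.
have mc y' : cell_shape c y' -> model g y'.
  by move=> cy; exact: (polyhedron_model (cell_polyhedron c) cy).
have pA := isometry_form isoA.
have sphereA y' : corner_sphere v r y' -> corner_sphere v r (y' *m A).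
  move=> [cy' dy']; split; first exact: isometry_sub isoA _ cy'.
  by rewrite -{1}vA (preserves_mdist pA) //; exact: mc.
have [w Sw hw] : (h @` closed_simplex S) (char_map c y) by rewrite hS; exists y.
have [w' Sw' hw'] : (h @` closed_simplex S) (f (char_map c y)).
  rewrite hS fA; last by case: Sy.
  by exists (y *m A) => //; exact: sphereA.
rewrite -hw' -hw; congr h; apply: (lform_vertex_separates SL Sw' Sw) => t tS.
have Stt : closed_simplex S (vertex_point t) by apply/closed_simplex_vertex_point.
have [yt Syt hyt] : (char_map c @` corner_sphere v r) (h (vertex_point t)).
  by rewrite -hS; exists (vertex_point t).
have hytA : h (vertex_point t) = char_map c (yt *m A).
  by rewrite -fA; [rewrite hyt act perm1 | case: Syt].
have cy : cell_shape c y by case: Sy.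
have cyt : cell_shape c yt by case: Syt.
have e1 := iso _ _ _ _ Sw Stt Sy Syt hw (esym hyt).
have hw'A : h w' = char_map c (y *m A) by rewrite hw' fA.
have e2 := iso _ _ _ _ Sw' Stt (sphereA _ Sy) (sphereA _ Syt) hw'A hytA.
have acos_inj (a b : R) : -1 <= a <= 1 -> -1 <= b <= 1 -> acos a = acos b -> a = b.
  by move=> ha hb e; rewrite -(@acosK _ a) ?in_itv // e acosK ?in_itv.
apply: acos_inj; [exact: lform_vertex_range tS|exact: lform_vertex_range tS|].
rewrite e1 e2 -{1}vA (preserves_angle pA) //; exact: mc.
Qed.

Hypothesis vx : vertices X x.

(** Let [f] carry the corner [v] of [c] to the corner [v *m A] of [c']. Acting
    trivially on the link, [f] maps the small sphere about [v] in [c] to itself,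
    so that both corners cut out the same subset of [X]. As this sphere meets the
    open cell, [c = c'], and then [v *m A = v], because points of [c] on the side
    of [v] of the bisecting hyperplane have different distances to two distinct
    corners. Now [f] fixes the sphere pointwise, and so a point on the ray from
    [v] to each of a spanning family of points of [c]: hence [A = 1]. The radius
    has to be smaller than the distances from [v] to the points of [c] that are
    used. *)
Lemma link_action_faithful_cell f c : f x = x -> closed_cell c x ->
  \forall r \near (0 : R)^'+, forall h : {ffun lvertex L -> R} -> X,
    link_chart x r h -> link_action h f 1%g ->
    forall z, closed_cell c z -> f z = z.
Proof.
move=> fx cx; have [c0|c_gt0] := posnP (cdim c).
  by apply: filterE => r h _ _ z cz; rewrite -(closed_cell_dim0 c0 cx cz).
have [v cv vxE] := cx; have cornv : corner x v by [].
have nov : ~ open_shape g c v.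
  move=> ov; case: vx => e e0 ex; have ce : c = e.
    by apply: open_cell_unique ex; rewrite -vxE; exists v.
  by move: c_gt0; rewrite ce e0.
have mc y : cell_shape c y -> model g y.
  by move=> cy; exact: (polyhedron_model (cell_polyhedron c) cy).
have far y0 : open_shape g c y0 -> 0 < mdist g v y0.
  move=> oy; apply: mdist_gt0; [exact: mc|exact: (mc _ (open_polyhedron_sub oy))|].
  by apply: contra_notN nov => /eqP ->.
have [c' [A [A' [dimc isoA fA]]]] := aut_cell f c.
have cornv' := corner_image fx dimc isoA fA cornv.
have sphereE r (h : {ffun lvertex L -> R} -> X) : link_chart x r h -> link_action h f 1%g ->
    char_map c @` corner_sphere v r = char_map c' @` corner_sphere (v *m A) r.
  move=> ch act; have [_ corners _] := ch.
  have [S vS] := corners _ _ cornv; have [S' vS'] := corners _ _ cornv'.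
  have := link_action_simplex ch act dimc isoA fA cv vS vS'.
  rewrite (eq_imset _ (@perm1 _)) imset_id => SS'; subst S'.
  by case: vS => _ _ <- _; case: vS'.
have open_match y y' : open_shape g c y -> cell_shape c' y' ->
    char_map c y = char_map c' y' -> open_shape g c' y'.
  move=> oy cy' e; apply: contrapT => noy'.
  have [e' lt_e e'y] := cell_boundary cy' noy'.
  have ce : c = e' by apply: open_cell_unique e'y; rewrite -e; exists y.
  by move: lt_e; rewrite -dimc ce ltnn.
(* At a point of the sphere on the segment from [v] to [y0], which is in the open
   cell, the sphere about the other corner passes as well. *)
have meet r (h : {ffun lvertex L -> R} -> X) y0 : link_chart x r h -> link_action h f 1%g -> 0 < r ->
    open_shape g c y0 -> r <= mdist g v y0 ->
    exists s t y', [/\ 0 <= s, 0 < t, open_shape g c (s *: v + t *: y0),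
      mdist g v (s *: v + t *: y0) = r
      & corner_sphere (v *m A) r y' /\
        char_map c (s *: v + t *: y0) = char_map c' y'].
  move=> ch act r0 oy0 r_le.
  have [s [t [s0 t0 oy dy]]] : exists s t, [/\ 0 <= s, 0 < t,
      open_shape g c (s *: v + t *: y0) & mdist g v (s *: v + t *: y0) = r].
    by apply: (polyhedron_geodesic_point (cell_polyhedron c)) => //; rewrite r0.
  have [y' Sy' e] : (char_map c' @` corner_sphere (v *m A) r)
      (char_map c (s *: v + t *: y0)).
    rewrite -(sphereE _ _ ch act); exists (s *: v + t *: y0) => //.
    by split=> //; exact: (open_polyhedron_sub oy).
  by exists s, t, y'.
have near0 : \forall r \near (0 : R)^'+, 0 < r by exact: nbhs_right_gt.
have [cc'|neq] := pselect (c = c'); last first.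
  have [y0 oy0] := open_polyhedron_neq0 (cell_polyhedron c).
  apply: filterS2 near0 (nbhs_right_ltW (far _ oy0)) => r r0 r_le h ch act.
  have [s [t [y' [_ _ oy _ [[cy' _] e]]]]] := meet _ _ _ ch act r0 oy0 r_le.
  case: neq; apply: (open_cell_unique (x := char_map c' y')).
    by rewrite -e; exists (s *: v + t *: y0).
  by exists y' => //; exact: open_match oy cy' e.
subst c'; have mv' : model g (v *m A) by apply: mc; case: cornv'.
have [vA|neq] := pselect (v *m A = v); last first.
  have vv' : v != v *m A by apply/eqP => /esym.
  have [l lv bis] := bisector (mc _ cv) mv' vv'.
  have [y0 oy0 ly0] := open_polyhedron_dense (cell_polyhedron c) cv (near_form_gt lv).
  apply: filterS2 near0 (nbhs_right_ltW (far _ oy0)) => r r0 r_le h ch act.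
  have [s [t [y' [s0 t0 oy dy [[cy' dy'] e]]]]] := meet _ _ _ ch act r0 oy0 r_le.
  have yy' : s *: v + t *: y0 = y'.
    by apply: (@char_map_inj _ _ _ _ c); rewrite ?inE //; exact: open_match oy cy' e.
  case: (bis (s *: v + t *: y0)).
  - exact: (mc _ (open_polyhedron_sub oy)).
  - have -> : ((s *: v + t *: y0) *m l) 0 0 = s * (v *m l) 0 0 + t * (y0 *m l) 0 0.
      by rewrite mulmxDl -!scalemxAl [LHS]mxE [X in X + _ = _]mxE [X in _ + X = _]mxE.
    by apply: ltr_wpDl; [rewrite mulr_ge0 // ltW | exact: mulr_gt0].
  - by rewrite dy yy'.
have [k [Y [fY oY]]] := open_polyhedron_spanning (cell_polyhedron c).
have nearY : \forall r \near (0 : R)^'+, forall i, r <= mdist g v (row i Y).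
  apply: (@filter_forall _ _ (fun i r => r <= mdist g v (row i Y))) => i.
  exact: nbhs_right_ltW (far _ (oY i)).
apply: filterS2 near0 nearY => r r0 r_le h ch act.
have [_ corners _] := ch; have [S vS] := corners _ _ cornv.
have fixS := link_simplex_fixed isoA fA cv vA act vS.
have rowA i : row i Y *m A = row i Y.
  have [s [t [_ [s0 t0 oy dy _]]]] := meet _ _ _ ch act r0 (oY i) (r_le i).
  have cy := open_polyhedron_sub oy.
  have : (s *: v + t *: row i Y) *m A = s *: v + t *: row i Y.
    apply: (@char_map_inj _ _ _ _ c); rewrite ?inE //.
      exact: isometry_open isoA _ oy.
    by rewrite -fA // fixS.
  rewrite mulmxDl -!scalemxAl vA => /addrI/scalerI; apply.
  by rewrite gt_eqF.
have A1 : A = 1%:M.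
  have YA : Y *m A = Y by apply/row_matrixP => i; rewrite row_mul rowA.
  have /row_fullP[W WY] := fY.
  by rewrite -[A]mul1mx -WY -mulmxA YA.
by move=> z [y cy <-]; rewrite fA // A1 mulmx1.
Qed.

End Faithfulness.

(** * Finite groups of automorphisms *)

Section FiniteSubgroup.
Variables (G : groupType) (S : set G).

Definition subgroup_set :=
  [/\ S 1%g, forall a b, S a -> S b -> S (a * b)%g & forall a, S a -> S a^-1%g].

Hypotheses (finS : finite_set S) (subS : subgroup_set).

(** The two proofs are arguments for the group structure to be canonical. *)
Definition finite_subgroup of finite_set S & subgroup_set : Type := fset_set S.

Local Notation T := (finite_subgroup finS subS).

HB.instance Definition _ := Finite.on T.

Definition subgroup_val (a : T) : G := val a.

Lemma subgroup_val_inj : injective subgroup_val.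
Proof. exact: val_inj. Qed.

Lemma subgroup_valP a : S (subgroup_val a).
Proof. by have := fsvalP a; rewrite in_fset_set // inE. Qed.

Fact mem_fset_set b : S b -> b \in fset_set S.
Proof. by move=> Sb; rewrite in_fset_set // inE. Qed.

Definition to_subgroup b (Sb : S b) : T := FSetSub (mem_fset_set Sb).

Fact mul_closed a b : S (subgroup_val a * subgroup_val b)%g.
Proof. by case: subS => _ SM _; apply: SM; exact: subgroup_valP. Qed.

Fact inv_closed a : S (subgroup_val a)^-1%g.
Proof. by case: subS => _ _ SV; apply: SV; exact: subgroup_valP. Qed.

Fact one_closed : S 1%g. Proof. by case: subS. Qed.

Let mul a b := to_subgroup (mul_closed a b).
Let inv a := to_subgroup (inv_closed a).
Let one := to_subgroup one_closed.

Fact subgroup_mulA : associative mul.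
Proof. by move=> a b c; apply: subgroup_val_inj; exact: mulgA. Qed.

Fact subgroup_mul1 : left_id one mul.
Proof. by move=> a; apply: subgroup_val_inj; exact: mul1g. Qed.

Fact subgroup_mulV : left_inverse one inv mul.
Proof. by move=> a; apply: subgroup_val_inj; exact: mulVg. Qed.

HB.instance Definition _ :=
  Finite_isGroup.Build T subgroup_mulA subgroup_mul1 subgroup_mulV.

Lemma subgroup_valM : {morph subgroup_val : a b / (a * b)%g}.
Proof. by []. Qed.

Lemma card_finite_subgroup : #|[set: T]%SET| = #|` fset_set S|%fset.
Proof. by rewrite cardsT cardfE. Qed.

End FiniteSubgroup.

Section LocalRepresentation.
Context {R : realType} {g : geometry} {d : nat} {X : polyhedralComplex R g d}.
Hypothesis X_locally_finite : locally_finite X.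
Variables (T : finGroupType) (iota : T -> PolyAut X).
Hypothesis iotaM : {morph iota : a b / (a * b)%g}.
Implicit Types (c : cell X) (a b : T).

Lemma iota1 : iota 1%g = 1%g.
Proof. by apply: (mulgI (iota 1%g)); rewrite -iotaM !mulg1. Qed.

Lemma iotaV a : iota a^-1%g = (iota a)^-1%g.
Proof. by apply: (mulgI (iota a)); rewrite -iotaM !mulgV iota1. Qed.

Lemma iotaVK a : cancel (iota a) (iota a^-1%g).
Proof. by move=> z; rewrite iotaV; exact: aut_funK. Qed.

Lemma finite_near (I : Type) (D : set I) (T' : Type) (F : set_system T')
    (P : I -> set T') {FF : Filter F} : finite_set D ->
  (forall i, D i -> F (P i)) -> \forall r \near F, forall i, D i -> P i r.
Proof.
move=> finD FP; have finPD : finite_set (P @` D) by exact: finite_image.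
have := @filter_bigI _ _ (fset_set (P @` D)) id F FF.
have FPD A : A \in fset_set (P @` D) -> F A.
  by rewrite in_fset_set // inE => -[i Di <-]; exact: FP.
move=> /(_ FPD); apply: filterS => r all_r i Di; apply: (all_r (P i)) => /=.
by rewrite in_fset_set // inE; exists i.
Qed.

Definition fixes_pointwise (A : set X) a := forall z, A z -> iota a z = z.

Lemma fixes_pointwiseV A a : fixes_pointwise A a -> fixes_pointwise A a^-1%g.
Proof. by move=> fixA z Az; rewrite -{1}(fixA z Az) iotaVK. Qed.

(** The representation on the link of [x] of a group that fixes [x]. As there are
    finitely many elements and finitely many cells at [x], one radius is small
    enough for all of them. Permutations compose from left to right and
    automorphisms from right to left; so [rho a] is the permutation induced by
    the inverse of [a]. *)
Lemma local_representation (H : {group T}) (x : X) (L : sphericalComplex R) :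
  vertices X x -> link_isometric x L -> (forall a, a \in H -> iota a x = x) ->
  exists rho : T -> {perm lvertex L},
    [/\ {in H &, {morph rho : a b / (a * b)%g}},
        forall a, a \in H -> rho a \in saut L,
        forall a c, a \in H -> rho a = 1%g -> closed_cell c x ->
          fixes_pointwise (closed_cell c) a
      & forall a c, a \in H -> closed_cell c x -> (0 < cdim c)%N ->
          fixes_pointwise (closed_cell c) a ->
          exists S, [/\ S \in simplices L, #|S| = cdim c & rho a \in sfix S]].
Proof.
move=> vx lk Hx.
have fin_cells : finite_set [set c | closed_cell c x].
  have [U Ux] := X_locally_finite x; apply: sub_finite_set => c cx.
  by exists x; split=> //; exact: nbhs_singleton.
have faithful : \forall r \near (0 : R)^'+, forall a c, a \in H -> closed_cell c x ->
    forall h : {ffun lvertex L -> R} -> X,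
    link_chart x r h -> link_action h (iota a) 1%g -> fixes_pointwise (closed_cell c) a.
  apply: (@filter_forall _ _ (fun a r => forall c, a \in H -> closed_cell c x ->
    forall h : {ffun lvertex L -> R} -> X,
    link_chart x r h -> link_action h (iota a) 1%g -> fixes_pointwise (closed_cell c) a)) => a.
  have [aH|aH] := boolP (a \in H); last by apply: filterE => r /= c.
  have near_c c : closed_cell c x -> \forall r \near (0 : R)^'+,
    forall h : {ffun lvertex L -> R} -> X,
    link_chart x r h -> link_action h (iota a) 1%g -> fixes_pointwise (closed_cell c) a.
    exact: (link_action_faithful_cell L vx (Hx a aH)).
  by apply: filterS (@finite_near _ _ _ (0 : R)^'+ _ _ fin_cells near_c) => r all_r c _; exact: all_r.
have charts : \forall r \near (0 : R)^'+, exists h : {ffun lvertex L -> R} -> X,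
  link_chart x r h by exact: lk.
have [r [faith_r [h ch]]] := @filter_ex _ (0 : R)^'+ _ _ (filterI faithful charts).
have act a : exists s, a \in H -> link_action h (iota a^-1%g) s.
  have [aH|aH] := boolP (a \in H); last by exists 1%g.
  have aVx : iota a^-1%g x = x by apply: Hx; rewrite groupV.
  by have [s hs] := link_action_exists ch aVx; exists s.
have /choice[rho rhoP] := act.
exists rho; split.
- move=> a b aH bH; apply: (link_action_uniq ch (rhoP _ (groupM aH bH))).
  rewrite invMg iotaM; exact: (link_action_comp (rhoP b bH) (rhoP a aH)).
- move=> a aH; apply: (link_action_saut ch _ (rhoP a aH)).
  by apply: Hx; rewrite groupV.
- move=> a c aH rho1 cx; rewrite -[a]invgK; apply: fixes_pointwiseV.
  apply: (faith_r _ _ _ cx h ch); first by rewrite groupV.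
  by rewrite -rho1; exact: rhoP.
- move=> a c aH cx c0 fixc; apply: (link_action_fix ch (rhoP a aH) _ cx c0).
    by apply: Hx; rewrite groupV.
  exact: fixes_pointwiseV.
Qed.

End LocalRepresentation.

(** * Primes that divide the order of a stabiliser *)

Section StabiliserOrders.
Context {R : realType} {g : geometry} {d : nat} {X : polyhedralComplex R g d}.
Hypothesis X_connected : connected [set: X].
Hypothesis X_locally_finite : locally_finite X.
Variables (m : nat) (L : 'I_m -> sphericalComplex R).
Hypothesis links : forall x : X, vertices X x -> exists i, link_isometric x (L i).
Variables (T : finGroupType) (iota : T -> PolyAut X).
Hypothesis iotaM : {morph iota : a b / (a * b)%g}.
Hypothesis iota_inj : injective iota.
Implicit Types (c : cell X) (a b : T) (x : X).

(** Fixing a top-dimensional cell propagates to the whole complex if it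
    propagates around each vertex, since adjacent cells share a vertex. *)
Lemma fixes_all c0 a : cdim c0 = d -> fixes_pointwise iota (closed_cell c0) a ->
  (forall w c c', vertices X w -> cdim c = d -> closed_cell c w ->
    fixes_pointwise iota (closed_cell c) a -> closed_cell c' w ->
    fixes_pointwise iota (closed_cell c') a) -> a = 1%g.
Proof.
move=> dim0 fix0 propagate; apply: iota_inj; rewrite (iota1 iotaM).
apply: aut_eq => z /=.
have fix_all := @adjacency_connected _ _ _ X X_locally_finite
  [set c | fixes_pointwise iota (closed_cell c) a] X_connected.
have adj c c' : cdim c = d -> cdim c' = d -> fixes_pointwise iota (closed_cell c) a ->
    closed_cell c `&` closed_cell c' !=set0 -> fixes_pointwise iota (closed_cell c') a.
  move=> dc dc' fixc [y [cy c'y]]; have [w [vw cw c'w]] := common_vertex cy c'y.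
  exact: (propagate w c c').
have [e ez] := open_cell_exists z; have [_ _ pureX] := complex_pure X.
have [c dc ec] := pureX e.
by apply: (fix_all adj c0 dim0 fix0 c dc); apply/ec/open_cell_sub.
Qed.

Lemma top_cell_at x : exists2 c, cdim c = d & closed_cell c x.
Proof.
have [e ex] := open_cell_exists x; have [_ _ pureX] := complex_pure X.
by have [c dc ec] := pureX e; exists c => //; apply/ec/open_cell_sub.
Qed.

Lemma fixes_cycle a (z : X) : iota a z = z -> forall b, b \in <[a]>%g -> iota b z = z.
Proof.
move=> az b /cycleP[k ->]; elim: k => [|k ih].
  by rewrite expg0 (iota1 iotaM).
by rewrite expgS iotaM /= ih.
Qed.

Lemma representation_order (H : {group T}) (P : finGroupType) (rho : T -> P) a :
  {in H &, {morph rho : a b / (a * b)%g}} -> a \in H -> (#[rho a]%g %| #[a]%g)%N.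
Proof.
move=> rhoM aH; exact: (morph_order (Morphism rhoM) aH).
Qed.

Variables (x : X) (vx : vertices X x) (fix_x : forall a, iota a x = x).

(** An element of prime order [q] acts on the link of each vertex that it fixes
    through a group of order [1] or [q]. If [q] divides the order of no
    automorphism group of a link, it acts trivially, and so fixes the star of
    this vertex; it fixes everything by propagation, starting at [x]. *)
Lemma prime_divides_link q : prime q -> (q %| #|[set: T]%SET|)%N ->
  exists i, (q %| #|saut (L i)|)%N.
Proof.
move=> q_pr qT; have [a _ oa] := Cauchy q_pr qT.
apply: contrapT => no_i.
have star w : vertices X w -> iota a w = w ->
    forall c, closed_cell c w -> fixes_pointwise iota (closed_cell c) a.
  move=> vw aw; have [i lk] := links vw.
  have [rho [rhoM rho_saut rho_faithful _]] :=
    local_representation X_locally_finite iotaM vw lk (fixes_cycle aw).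
  have aa : a \in <[a]>%g := cycle_id a.
  have rho1 : rho a = 1%g.
    have /primeP[_ q_dvd] := q_pr.
    have := representation_order rhoM aa; rewrite oa => /q_dvd/orP[/eqP o1|/eqP oq].
      by apply/eqP; rewrite -order_eq1 o1.
    by case: no_i; exists i; rewrite -oq; apply: order_dvdG; exact: rho_saut.
  by move=> c cw; exact: rho_faithful aa rho1 cw.
have [c0 dim0 c0x] := top_cell_at x.
have a1 : a = 1%g.
  apply: (fixes_all dim0 (star x vx (fix_x a) c0 c0x)) => w c c' vw _ cw fixc c'w.
  by apply: (star w vw _ c' c'w); exact: fixc.
by move: oa q_pr; rewrite a1 order1 => <-.
Qed.

(** A Sylow [p]-subgroup acts faithfully on the link of [x]. Otherwise some
    element [b] of order [p] acts trivially, and so fixes a [d]-cell at [x]. At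
    each vertex of a [d]-cell that it fixes, it acts on the link by an element
    that fixes a [(d-1)]-simplex pointwise and has order [1] or [p], hence
    trivially; so it fixes the star of this vertex, and everything by
    propagation. *)
Lemma sylow_divides_link p : prime p ->
  (forall i s, s \in simplices (L i) -> #|s| = d -> ~~ (p %| #|sfix s|)%N) ->
  exists i, (p ^ logn p #|[set: T]%SET| %| #|saut (L i)|)%N.
Proof.
move=> p_pr p_fix; have [i lk] := links vx; exists i.
have [rho [rhoM rho_saut rho_faithful _]] := local_representation
  X_locally_finite iotaM vx lk (fun a (_ : a \in [set: T]%G) => fix_x a).
have [P sylP] := Sylow_exists p [set: T]%G.
have rhoP_inj a : a \in P -> rho a = 1%g -> a = 1%g.
  move=> aP rho1; apply/eqP; apply: contraT => aN1.
  have pa : (p.-elt a)%g by apply: mem_p_elt (pHall_pgroup sylP) aP.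
  have [b ba ob] : {b | b \in <[a]>%g & #[b]%g = p}.
    apply: Cauchy => //; have := pa; rewrite /p_elt => /p_natP[[|k] ka].
      by move: aN1; rewrite -order_eq1 ka.
    by rewrite -[#|_|]/(#[a]%g) ka expnS dvdn_mulr.
  have rho_b : rho b = 1%g.
    have /cycleP[k ->] := ba.
    by have := morphX (Morphism rhoM) k (finset.in_setT a); rewrite /= rho1 expg1n.
  have [c0 dim0 c0x] := top_cell_at x.
  have b1 : b = 1%g.
    apply: (fixes_all dim0 (rho_faithful _ _ (finset.in_setT b) rho_b c0x)).
    move=> w c c' vw dc cw fixc c'w.
    (* Cells of dimension [0] do not appear in the link. *)
    have [d0|d_gt0] := posnP d.
      move=> z c'z; have c'0 : cdim c' = 0%N.
        have [_ le_d _] := complex_pure X.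
        by apply/eqP; rewrite -leqn0 -d0.
      by rewrite -(closed_cell_dim0 c'0 c'w c'z); exact: fixc.
    have bw : iota b w = w by exact: fixc.
    have bb : b \in <[b]>%g := cycle_id b.
    have [j lkw] := links vw.
    have [rho' [rho'M _ rho'_faithful rho'_fix]] :=
      local_representation X_locally_finite iotaM vw lkw (fixes_cycle bw).
    have c_gt0 : (0 < cdim c)%N by rewrite dc.
    have [S [SL cardS rhoS]] := rho'_fix b c bb cw c_gt0 fixc.
    apply: (rho'_faithful _ _ bb _ c'w).
    have /primeP[_ p_dvd] := p_pr.
    have := representation_order rho'M bb; rewrite ob => /p_dvd/orP[/eqP o1|/eqP op].
      by apply/eqP; rewrite -order_eq1 o1.
    have := p_fix j S SL; rewrite cardS dc => /(_ erefl)/negP[].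
    by rewrite -op; exact: order_dvdG.
  by move: ob p_pr; rewrite b1 order1 => <-.
have PT : P \subset [set: T]%G by exact: finset.subsetT.
pose rhoP := restrm PT (Morphism rhoM).
have inj : ('injm rhoP)%g.
  apply/fintype.subsetP => a; rewrite !inE /= => /andP[aP /eqP rho1].
  by apply/eqP; exact: rhoP_inj.
rewrite -p_part -(card_Hall sylP) -(card_injm inj (subxx P)).
apply: cardSg.
apply/fintype.subsetP => _ /morphimP[a aP _ ->]; exact: (rho_saut a (finset.in_setT a)).
Qed.

End StabiliserOrders.

(** * Orbits of vertices *)

Section Orbits.
Context {R : realType} {g : geometry} {d : nat} {X : polyhedralComplex R g d}.
Local Open Scope quotient_scope.

Lemma open_ball_stabiliser (f : PolyAut X) (c : cell X) (n : nat) :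
  open [set h : PolyAut X | forall x, comb_ball c n x -> h x = f x].
Proof.
set U := [set h : PolyAut X | _].
exists [set U]; last by rewrite bigcup_set1.
move=> _ ->; exists [fset U]%fset; last first.
  apply/seteqP; split=> [h hU|h Uh V VU]; first by apply: (hU U); exact: fset11.
  by have /fset1P -> : V \in [fset U]%fset := VU.
by move=> V /fset1P ->; rewrite inE; exists f, c, n.
Qed.

Variable Gamma : groupClosed (PolyAut X).

Lemma orbit_eqP (x y : X) :
  \pi_(orbit_space Gamma) x = \pi_(orbit_space Gamma) y <->
  exists2 f : PolyAut X, f \in Gamma & f x = y.
Proof.
split=> [/eqP|[f Gf fxy]].
  by rewrite eqmodE => /asboolP.
by apply/eqP; rewrite eqmodE; apply/asboolP; exists f.
Qed.

(** The map from [Gamma \ G] to the set of orbits that [f |-> Gamma f x] induces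
    is locally constant, because automorphisms close to [f] agree with [f] at the
    vertex [x]; so it has finite image. *)
Lemma finite_orbit_translates x : compact [set: coset_space Gamma] ->
  vertices X x ->
  finite_set (range (fun f : PolyAut X => \pi_(orbit_space Gamma) (f x))).
Proof.
move=> cpt [c c0 cx].
pose Phi (u : coset_space Gamma) : orbit_space Gamma := \pi_(orbit_space Gamma) (repr u x).
have PhiE (f : PolyAut X) : Phi (\pi_(coset_space Gamma) f) = \pi_(orbit_space Gamma) (f x).
  rewrite /Phi; set h := repr _; apply/(orbit_eqP (h x) (f x)).
  have hf : \pi_(coset_space Gamma) h = \pi_(coset_space Gamma) f by rewrite reprK.
  have /eqP : h = f %[mod {eq_quot (coset_equiv Gamma)}] by exact: hf.
  rewrite eqmodE => fh; exists (f * h^-1)%g => //.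
  by rewrite /= aut_funK.
have Phi_open q : open [set u | Phi u = q].
  have E : \pi_(coset_space Gamma) @^-1` [set u | Phi u = q] =
    [set f : PolyAut X | \pi_(orbit_space Gamma) (f x) = q].
    by apply/seteqP; split=> f; rewrite /= PhiE.
  suff : open (\pi_(coset_space Gamma) @^-1` [set u | Phi u = q]) by [].
  rewrite E openE => f fq.
  have nf : nbhs f [set h : PolyAut X | forall y, comb_ball c 0 y -> h y = f y].
    by apply: open_nbhs_nbhs; split=> //; exact: open_ball_stabiliser.
  by apply: filterS nf => h hf /=; rewrite hf //; exact: open_cell_sub.
have covered : [set: coset_space Gamma] `<=` cover setT (fun q => [set u | Phi u = q]).
  by move=> u _; exists (Phi u).
move: cpt; rewrite compact_cover => cpt.
have [D _ cov] := cpt _ setT _ (fun q _ => Phi_open q) covered.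
apply: (@sub_finite_set _ _ [set` D]); last exact: finite_fset.
move=> _ [f _ <-]; have [q Do] := cov (\pi_(coset_space Gamma) f) I.
by rewrite /= PhiE => ->.
Qed.

(** Each of the finitely many [G]-orbits of 0-cells splits into finitely many
    [Gamma]-orbits. *)
Lemma finite_vertex_orbits : finite_quotient X -> compact [set: coset_space Gamma] ->
  finite_set [set q : orbit_space Gamma | vertices X (repr q)].
Proof.
move=> finq cpt; pose cls (c : cell X) := [set c' : cell X |
  exists f : PolyAut X, f @` open_cell g c = open_cell g c'].
pose Q K := [set q : orbit_space Gamma | exists2 c, cdim c = 0%N &
  open_cell g c (repr q) /\ cls c = K].
apply: (@sub_finite_set _ _ (\bigcup_(K in range cls) Q K)).
  by move=> q [c c0 cq]; exists (cls c); [exists c | exists c].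
apply: bigcup_finite => [|K _]; first exact: finq.
have [[q0 [c0 dim0 [c0q clsK]]]|empty] := pselect (Q K !=set0); last first.
  by rewrite (_ : Q K = set0) //; apply/seteqP; split=> // q Qq; case: empty; exists q.
have v0 : vertices X (repr q0) by exists c0.
apply: sub_finite_set (finite_orbit_translates cpt v0) => q [c dimc [cq clscK]].
have [f fc] : cls c0 c.
  by rewrite clsK -clscK; exists 1%g; rewrite image_id.
exists f => //; rewrite -[q]reprK; congr (\pi_(orbit_space Gamma) _).
apply: (closed_cell_dim0 dimc); last exact: open_cell_sub.
by apply: open_cell_sub; rewrite -fc; exists (repr q0).
Qed.

Lemma stabiliser_subgroup x : subgroup_set (stabiliser Gamma x).
Proof.
split=> [|a b [Ga ax] [Gb bx]|a [Ga ax]]; first by split=> //; exact: gpred1.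
  by split; [exact: gpredM | rewrite /= bx].
by split; [exact: gpredVr | rewrite /= -{1}ax aut_funK].
Qed.

End Orbits.

(** * Arithmetic *)

Lemma prime_power_dvd_lcm (I : eqType) (s : seq I) (P : pred I) (F : I -> nat) p k :
  prime p -> (0 < k)%N -> (forall i, P i -> 0 < F i)%N ->
  (p ^ k %| \big[lcmn/1%N]_(i <- s | P i) F i)%N ->
  exists2 i, i \in s & P i /\ (p ^ k %| F i)%N.
Proof.
move=> p_pr k0 F0; elim: s => [|i s ih].
  by rewrite big_nil -(expn0 p) dvdn_Pexp2l ?prime_gt1 // leqNgt k0.
have ih' : (p ^ k %| \big[lcmn/1%N]_(i <- s | P i) F i)%N ->
    exists2 i0, i0 \in i :: s & P i0 /\ (p ^ k %| F i0)%N.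
  by move=> /ih[i' i's ?]; exists i' => //; rewrite in_cons i's orbT.
rewrite big_cons; case: ifP => Pi //.
set l := \big[_/_]_(_ <- s | _) _; have l0 : (0 < l)%N.
  apply: (big_ind (fun n => 0 < n)%N) => // a b; rewrite lcmn_gt0 => -> ->.
  by [].
have Fi := F0 i Pi.
rewrite pfactor_dvdn ?lcmn_gt0 ?Fi ?l0 // logn_lcm // leq_max => /orP[]le.
  by exists i; [exact: mem_head | split=> //; rewrite pfactor_dvdn].
by apply: ih'; rewrite -/l pfactor_dvdn.
Qed.

(** A sum of unit fractions is a fraction whose denominator divides the least
    common multiple of the [F i]; terms with [F i = 0] are zero because
    [0^-1 = 0]. *)
Lemma sum_unit_fractions (R : realType) (I : eqType) (s : seq I) (F : I -> nat) :
  exists a b : nat, [/\ (0 < b)%N, coprime a b,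
    \sum_(i <- s) (F i)%:R^-1 = a%:R / b%:R :> R
    & forall p k, prime p -> (0 < k)%N -> (p ^ k %| b)%N ->
        exists2 i, i \in s & (0 < F i)%N /\ (p ^ k %| F i)%N].
Proof.
pose l := \big[lcmn/1%N]_(i <- s | (0 < F i)%N) F i.
have l0 : (0 < l)%N.
  apply: (big_ind (fun n => 0 < n)%N) => // a b; rewrite lcmn_gt0 => -> ->.
  by [].
have dvd_l : all (fun i => (0 < F i)%N ==> (F i %| l)%N) s.
  rewrite /l; elim: (s) => //= i s' ih; rewrite big_cons.
  have [Fi|Fi] /= := ltnP 0 (F i); last exact: ih.
  rewrite dvdn_lcml /=; apply: sub_all ih => i' /implyP dvd.
  by apply/implyP => /dvd dvd'; exact: dvdn_trans dvd' (dvdn_lcmr _ _).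
have [N sumE] : exists N : nat, \sum_(i <- s) (F i)%:R^-1 = N%:R / l%:R :> R.
  move: (l) l0 dvd_l => l' l'0; elim: s {l} => [|i s' ih] /=.
    by exists 0%N; rewrite big_nil mul0r.
  move=> /andP[dvd /ih[N sumE]]; rewrite big_cons sumE.
  have [Fi|Fi] := posnP (F i); first by exists N; rewrite Fi invr0 add0r.
  rewrite Fi /= in dvd.
  exists (l' %/ F i + N)%N; rewrite natrD mulrDl; congr (_ + _).
  have q0 : (l' %/ F i)%:R != 0 :> R.
    by rewrite pnatr_eq0 -lt0n divn_gt0 // dvdn_leq.
  rewrite -[in RHS](divnK dvd) natrM mulnK //.
  by rewrite invfM mulrA divff // mul1r.
pose c := gcdn N l; have c0 : (0 < c)%N by rewrite gcdn_gt0 l0 orbT.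
have lc0 : (0 < l %/ c)%N by rewrite divn_gt0 // dvdn_leq // dvdn_gcdr.
have NE : N = (N %/ c * c)%N by rewrite divnK ?dvdn_gcdl.
have lE : l = (l %/ c * c)%N by rewrite divnK ?dvdn_gcdr.
exists (N %/ c)%N, (l %/ c)%N; split=> //.
- by rewrite /coprime -(eqn_pmul2r c0) muln_gcdl mul1n -NE -lE.
- rewrite sumE {1}NE {1}lE !natrM -mulf_div divff ?mulr1 //.
  by rewrite pnatr_eq0 -lt0n.
- move=> p k p_pr k0 pb; apply: prime_power_dvd_lcm => //.
  by apply: dvdn_trans pb _; rewrite -/l {2}lE dvdn_mulr.
Qed.

Lemma prime_dvd_prod_pfactors (M : nat) (p e : 'I_M -> nat) q :
  (forall j, prime (p j)) -> prime q -> (q %| \prod_(j < M) p j ^ e j)%N ->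
  exists2 j, q = p j & (0 < e j)%N.
Proof.
move=> p_pr q_pr; rewrite Euclid_dvd_prod // big_has => /hasP[j _] /=.
rewrite Euclid_dvdX // => /andP[qp e0]; exists j => //.
by apply/eqP; rewrite -dvdn_prime2.
Qed.

Lemma logn_prod_pfactors (M : nat) (p e : 'I_M -> nat) j :
  (forall k, prime (p k)) -> injective p ->
  logn (p j) (\prod_(k < M) p k ^ e k) = e j.
Proof.
move=> p_pr p_inj; have gt0 k : (0 < p k ^ e k)%N by rewrite expn_gt0 prime_gt0.
rewrite (bigD1 j) //= lognM ?gt0 //; last by apply: prodn_cond_gt0 => k _; exact: gt0.
rewrite pfactorK // -[RHS]addn0; congr addn; apply: logn_coprime.
apply: (big_ind (coprime (p j))) => [|a b ja jb|k kj]; first exact: coprimen1.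
  by rewrite coprimeMr ja.
apply: coprimeXr; rewrite prime_coprime // dvdn_prime2 //.
by apply: contra kj => /eqP/p_inj ->.
Qed.

(** * The orbifold volume *)

Section OrbifoldVolume.
Context {R : realType} {g : geometry} {d : nat} {X : polyhedralComplex R g d}.
Variable Gamma : groupClosed (PolyAut X).

(** An infinite stabiliser is assigned cardinality [0] and contributes [0^-1 = 0],
    so that the prime powers in [b] come from finite stabilisers. *)
Lemma orbifold_volume_fraction :
  finite_set [set q : orbit_space Gamma | vertices X (repr q)] ->
  exists a b : nat, [/\ (0 < b)%N, coprime a b,
    orbifold_volume Gamma = (a%:R / b%:R)%:E
    & forall q k, prime q -> (0 < k)%N -> (q ^ k %| b)%N -> exists x,
        [/\ vertices X x, finite_set (stabiliser Gamma x)
          & (q ^ k %| #|` fset_set (stabiliser Gamma x)|%fset)%N]].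
Proof.
set Q := [set q | _] => finQ.
pose F (q : orbit_space Gamma) := #|` fset_set (stabiliser Gamma (repr q))|%fset.
have [a [b [b0 ab sumE dvd]]] := sum_unit_fractions R (fset_set Q) F.
exists a, b; split=> // [|q k q_pr k0 /(dvd _ _ q_pr k0)[y yQ [Fy0 Fy]]].
  by rewrite /orbifold_volume -sumE esum_fset // fsbig_finite //= sumEFin.
exists (repr y); split=> //; first by move: yQ; rewrite in_fset_set // inE.
apply: contrapT => infinite; move: Fy0; rewrite /F /fset_set.
by case: pselect => // _; rewrite cardfs0.
Qed.

End OrbifoldVolume.

(** * Denominators of covolumes *)

Theorem theorem2 (R : realType) (g : geometry) (d : nat)
    (X : polyhedralComplex R g d)
    (X_connected : connected [set: X])
    (X_locally_finite : locally_finite X)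
    (X_finite_quotient : finite_quotient X)
    (m : nat) (L : 'I_m -> sphericalComplex R)
    (links : forall x : X, vertices X x -> exists i, link_isometric x (L i))
    (M : nat) (p alpha alpha' : 'I_M -> nat)
    (p_prime : forall j, prime (p j))
    (p_increasing : forall j k : 'I_M, (j < k)%N -> (p j < p k)%N)
    (alpha_gt0 : forall j, (0 < alpha j)%N)
    (lcm_Aut : \big[lcmn/1%N]_(i < m) #|saut (L i)|
               = (\prod_(j < M) p j ^ alpha j)%N)
    (* a (d-1)-cell of L i is a simplex with d vertices *)
    (lcm_Fix : \big[lcmn/1%N]_(i < m)
                 \big[lcmn/1%N]_(s in simplices (L i) | #|s| == d) #|sfix s|
               = (\prod_(j < M) p j ^ alpha' j)%N)
    (mu : {measure set (borelAut X) -> \bar R})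
    (mu_haar : haar_measure mu)
    (mu_normalised : normalised_covolume mu)
    (Gamma : groupClosed (PolyAut X))
    (Gamma_lattice : uniform_lattice Gamma) :
  exists a b : nat,
    [/\ (0 < b)%N, coprime a b,
        covolume mu Gamma = (a%:R / b%:R)%:E,
        forall q, prime q -> (q %| b)%N -> exists j, q = p j
      & forall j, alpha' j = 0%N -> ~~ (p j ^ (alpha j).+1 %| b)%N].
Proof.
have [_ cpt] := Gamma_lattice.
have p_inj : injective p.
  move=> j k pjk; apply: val_inj; case: (ltngtP j k) => // /p_increasing.
    by rewrite pjk ltnn.
  by rewrite pjk ltnn.
have aut_dvd n : (exists i, n %| #|saut (L i)|)%N ->
    (n %| \prod_(j < M) p j ^ alpha j)%N.
  move=> [i ni]; rewrite -lcm_Aut; apply: dvdn_trans ni _.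
  exact: (@biglcmn_sup _ i).
have [a [b [b0 ab volE dvd_b]]] :=
  orbifold_volume_fraction (finite_vertex_orbits X_finite_quotient cpt).
exists a, b; split=> //; first by rewrite (mu_normalised _ Gamma_lattice).
- move=> q q_pr; rewrite -[X in (X %| b)%N]expn1 => /(dvd_b _ _ q_pr (ltn0Sn 0)).
  move=> [x [vx fin]]; have subS := stabiliser_subgroup Gamma x.
  have fix_x f := (@subgroup_valP _ _ fin subS f).2.
  rewrite expn1 -(card_finite_subgroup fin subS) => q_dvd.
  have /aut_dvd := prime_divides_link X_connected X_locally_finite links
    (@subgroup_valM _ _ _ _) (@subgroup_val_inj _ _ _ _) vx fix_x q_pr q_dvd.
  by move=> /(prime_dvd_prod_pfactors p_prime q_pr)[j -> _]; exists j.
- move=> j alpha'0; apply/negP => /(dvd_b _ _ (p_prime j) (ltn0Sn _)).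
  move=> [x [vx fin]]; have subS := stabiliser_subgroup Gamma x.
  have fix_x f := (@subgroup_valP _ _ fin subS f).2.
  rewrite -(card_finite_subgroup fin subS) pfactor_dvdn ?cardG_gt0 // => le_log.
  have no_fix i s : s \in simplices (L i) -> #|s| = d -> ~~ (p j %| #|sfix s|)%N.
    move=> sL sd; apply/negP => pj_fix.
    have : (p j %| \prod_(k < M) p k ^ alpha' k)%N.
      rewrite -lcm_Fix; apply: (@biglcmn_sup _ i) => //.
      by apply: (@biglcmn_sup _ s) => //; rewrite sL sd eqxx.
    move=> /(prime_dvd_prod_pfactors p_prime (p_prime j))[k /p_inj <-].
    by rewrite alpha'0.
  have := sylow_divides_link X_connected X_locally_finite links
    (@subgroup_valM _ _ _ _) (@subgroup_val_inj _ _ _ _) vx fix_x (p_prime j) no_fix.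
  move=> /aut_dvd; rewrite pfactor_dvdn //; last first.
    by apply: prodn_gt0 => k; rewrite expn_gt0 prime_gt0.
  rewrite logn_prod_pfactors // => le_alpha.
  by have := leq_trans le_log le_alpha; rewrite ltnn.
Qed.
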